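(* Let $\alpha\in L_n$ and suppose that $\alpha$ is not maximal in $L_n$. Suppose that $\alpha'\in L_n$ is obtained from $\alpha$ by applying one elementary operation $\mathcal{E}_s$ or $\mathcal{E}_c$ on the cell which is the tail of the longest left sequence of even length which gives a lexical successor in $L_n$ (that is, on the cell $i$ of $\alpha$, where $i$ is the largest even index for which the elementary operation applied on cell $i$ of $\alpha$ yields an element of $L_n$). Let $f=\alpha\wedge\alpha'$, and assume further that $f\in L_m$ and $n=md+r$ with $0\le r<m$. 1. If $r>0$, then $\alpha$ is adjacent to $\alpha'$ in $L_n$. 2. If $r=0$, then $\alpha$ is adjacent to $f\star\lambda$ in $L_n$, where $\lambda$ is the least element of $L_d$.
   Context: An $\alpha$-sequence is a finite sequence $\alpha=(\alpha_1,\dots,\alpha_k)$ of positive integers; in addition the one-term sequence $(0)$ is admitted. Its length is $l(\alpha)=k$ and its degree is $D(\alpha)=\sum_{i=1}^k\alpha_i$. A left sequence of $\alpha$ is $(\alpha_1,\dots,\alpha_i)$, $1\le i\le k$, and its tail is $\alpha_i$; a right sequence of $\alpha$ is $(\alpha_i,\dots,\alpha_k)$, $1\le i\le k$. Order. For $\tau=(\tau_1,\dots,\tau_k)$ put $Al(\tau)=(\tau_1,-\tau_2,\tau_3,\dots,(-1)^{k-1}\tau_k,0,0,\dots)$. For $\tau\ne\tau'$ write $\tau>\tau'$ if the first nonzero term of $Al(\tau)-Al(\tau')$ is positive, and $\tau<\tau'$ if it is negative. This is a total order; minimal, maximal and least refer to it. If $\alpha<\beta$, $\beta$ is called a successor of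 $\alpha$ and $\alpha$ a preceding of $\beta$. For elements of a set $S$, ''$\alpha$ is adjacent to $\beta$ in $S$'' (written $\alpha\underset{adj}{<}\beta$) means $\alpha<\beta$ and there is no $\gamma\in S$ with $\alpha<\gamma<\beta$. A sequence $\alpha=(\alpha_1,\dots,\alpha_k)$ is lexical if $\alpha>(\alpha_i,\dots,\alpha_k)$ for all $2\le i\le k$. $L_n$ is the set of lexical sequences $\alpha$ with $1+D(\alpha)=n$; in particular $L_1=\{(0)\}$. Elementary operations. The $i$-th place of $\alpha$ is called its $i$-th cell, with value $\alpha_i$; it is positive if $i$ is odd and negative if $i$ is even. The elementary operation on cell $i$ is: if $\alpha_i>1$, splitting $\mathcal{E}_s$, which gives $(\alpha_1,\dots,\alpha_{i-1},\alpha_i-1,1,\alpha_{i+1},\dots,\alpha_k)$; if $\alpha_i=1$ (and $i\ge2$), conjugation $\mathcal{E}_c$, which gives $(\alpha_1,\dots,\alpha_{i-2},\alpha_{i-1}+1,\alpha_{i+1},\dots,\alpha_k)$. Wedge. $\alpha\wedge\alpha=\alpha$; for $\alpha\ne\beta$, if $i$ is the first place with $\alpha_i\neq\beta_i$, then $\alpha\wedge\beta=(\alpha_1,\dots,\alpha_{i-1},\min(\alpha_i,\beta_i))$. Products. $\alpha\beta$ is concatenation and $\alpha^q$ is $\alpha$ repeated $q$ times ($\alpha^0$ is empty). For $\alpha=(\alpha_1,\dots,\alpha_k)$: if $k$ is even, $\alpha_e=(\alpha_1,\dots,\alpha_k+1)$ and $\alpha_o=(\alpha_1,\dots,\alpha_k,1)$;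 if $k$ is odd, $\alpha_e=(\alpha_1,\dots,\alpha_k,1)$ and $\alpha_o=(\alpha_1,\dots,\alpha_k+1)$. The star product of $\alpha$ and $\beta=(\beta_1,\dots,\beta_k)$ is $\alpha\star\beta=\alpha_o(\alpha_e)^{\beta_1-1}\alpha_o(\alpha_e)^{\beta_2-1}\cdots\alpha_o(\alpha_e)^{\beta_k-1}\alpha$. *)

(* Defs.v *)
From mathcomp Require Import all_boot all_order all_algebra.

Set Implicit Arguments.
Unset Strict Implicit.
Unset Printing Implicit Defensive.

Import Order.TTheory GRing.Theory Num.Theory.

(* Cells are numbered from 1, so that the positive cells are the odd ones. *)
Definition cell (a : seq nat) (i : nat) : nat := nth 0 a i.-1.

Definition alpha_seq (a : seq nat) : bool :=
  (a == [:: 0]) || ((a != [::]) && all (fun x => 0 < x) a).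

Definition degree (a : seq nat) : nat := sumn a.

(* Indexed from 0, unlike [cell]; beyond the length of [t] the value is 0. *)
Definition Al (t : seq nat) (j : nat) : int :=
  ((-1) ^+ j * (nth 0%N t j)%:Z)%R.

Definition alt_lt (a b : seq nat) : Prop :=
  exists j : nat,
    (forall k : nat, k < j -> (Al a k - Al b k = 0)%R) /\
    (Al a j - Al b j < 0)%R.

Definition adjacent (S : seq nat -> Prop) (a b : seq nat) : Prop :=
  [/\ S a, S b, alt_lt a b & ~ exists c, [/\ S c, alt_lt a c & alt_lt c b]].

Definition is_maximal (S : seq nat -> Prop) (a : seq nat) : Prop :=
  S a /\ ~ exists b, S b /\ alt_lt a b.

Definition is_least (S : seq nat -> Prop) (a : seq nat) : Prop :=
  S a /\ forall b, S b -> b <> a -> alt_lt a b.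

(* [drop i.-1 a] is the right sequence starting at the cell [i]. *)
Definition lexical (a : seq nat) : Prop :=
  forall i : nat, 2 <= i <= size a -> alt_lt (drop i.-1 a) a.

Definition L (n : nat) (a : seq nat) : Prop :=
  [/\ alpha_seq a, lexical a & 1 + degree a = n].

Definition splitting (i : nat) (a : seq nat) : seq nat :=
  take i.-1 a ++ [:: (cell a i).-1; 1] ++ drop i a.

Definition conjugation (i : nat) (a : seq nat) : seq nat :=
  take i.-2 a ++ [:: (cell a i.-1).+1] ++ drop i a.

(* [None] when no elementary operation is defined on the cell [i]. *)
Definition elem_op (i : nat) (a : seq nat) : option (seq nat) :=
  if ~~ (1 <= i <= size a) then None
  else if 1 < cell a i then Some (splitting i a)
  else if (cell a i == 1) && (2 <= i) then Some (conjugation i a)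
  else None.

(* When one argument is a proper prefix of the other, the first differing place
   is outside one of them and the minimum is undefined; the common prefix is
   returned then. A sequence and its image under an elementary operation
   always differ at a place that belongs to both. *)
Fixpoint wedge (a b : seq nat) : seq nat :=
  match a, b with
  | x :: a', y :: b' => if x == y then x :: wedge a' b' else [:: minn x y]
  | _, _ => [::]
  end.

Definition seq_pow (a : seq nat) (q : nat) : seq nat := flatten (nseq q a).

(* For nonempty [a], [incr_nth a (size a).-1] adds 1 to the tail of [a]. *)
Definition seq_e (a : seq nat) : seq nat :=
  if odd (size a) then rcons a 1 else incr_nth a (size a).-1.

Definition seq_o (a : seq nat) : seq nat :=
  if odd (size a) then incr_nth a (size a).-1 else rcons a 1.

(* Meaningful when the terms of [b] are positive, so that [x.-1] is [x - 1]. *)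
Definition star (a b : seq nat) : seq nat :=
  flatten [seq seq_o a ++ seq_pow (seq_e a) x.-1 | x <- b] ++ a.

(* Main.v *)
Require Import Defs.
From mathcomp Require Import all_boot all_order all_algebra.
From mathcomp Require Import zify.

(* Replace a cell of value [x] by the block [R L^(x-1)] and end the word with a
   letter [C], where [L < C < R]: the order on sequences becomes the
   parity-lexicographic order of unimodal dynamics, lexical sequences become the
   words greater than all their proper suffixes, and an elementary operation
   flips one letter. Let [V] be the word of [f], and let [e], [o] be the letters
   for which [V e] is even and [V o] is odd. Then [a = V e Z], [a' = V o Z], and a
   lexical word between them is either [V e Z'] or [V o Z'] with [Z' > Z].
   The first case is excluded because flipping [a] just after its longest common
   prefix with [V e Z'] would contradict the choice of the cell. For the second
   one, if [Z'] lies below the periodic word [V e V e ...], its pieces are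
   rearranged (an initial factor [P] followed by a too large suffix [V x B] is
   turned into [B] followed by [V e] and [P]) into a word [Z'' > Z] of the same
   length having no suffix above [V]; the largest such word makes [V e Z'']
   lexical, which is the first case again. Otherwise [Z'] is a concatenation of
   blocks [V e] and [V o] ended by [V], so that [m] divides [n] and [V o Z'] is a
   star product [f * mu] with [mu] lexical; the smallest one is [f * lambda]. *)

Set Implicit Arguments.
Unset Strict Implicit.
Unset Printing Implicit Defensive.

(** * The parity-lexicographic order *)

Notation word := (seq bool).

(* [s] is the parity of the number of letters [true] read so far: an odd one
   reverses the order. *)
Fixpoint wlt_sgn (s : bool) (u v : word) : bool :=
  match u, v with
  | [::], [::] => false
  | [::], b :: _ => s (+) b
  | a :: _, [::] => ~~ (s (+) a)
  | a :: u', b :: v' => if a == b then wlt_sgn (s (+) a) u' v' else s (+) b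
  end.

Definition wlt := wlt_sgn false.

Lemma wlt_sgnN s u v : wlt_sgn (~~ s) u v = wlt_sgn s v u.
Proof.
elim: u v s => [|a u IH] [|b v] s //=; try by case: s; case: b.
  by case: s; case: a.
have [->|] := eqVneq b a; first by rewrite -IH addNb.
by case: s; case: a; case: b.
Qed.

Lemma wltTT u v : wlt (true :: u) (true :: v) = wlt v u.
Proof. exact: (wlt_sgnN false). Qed.

Lemma wltFF u v : wlt (false :: u) (false :: v) = wlt u v.
Proof. by []. Qed.

Lemma wltTF u v : wlt (true :: u) (false :: v) = false.
Proof. by []. Qed.

Lemma wltFT u v : wlt (false :: u) (true :: v) = true.
Proof. by []. Qed.

Lemma wlt0s b v : wlt [::] (b :: v) = b.
Proof. by []. Qed.

Lemma wlts0 a u : wlt (a :: u) [::] = ~~ a.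
Proof. by []. Qed.

Lemma wlt00 : wlt [::] [::] = false.
Proof. by []. Qed.

Definition wltE := (wltTT, wltFF, wltTF, wltFT, wlt0s, wlts0, wlt00).

Definition par (u : word) : bool := foldr addb false u.

Lemma par_cat u v : par (u ++ v) = par u (+) par v.
Proof. by elim: u => //= a u ->; rewrite addbA. Qed.

Lemma par_rcons u x : par (rcons u x) = par u (+) x.
Proof. by rewrite -cats1 par_cat /= addbF. Qed.

Lemma wlt_irr u : wlt u u = false.
Proof. by elim: u => // -[] u IH; rewrite wltE. Qed.

Lemma wlt_trans v u w : wlt u v -> wlt v w -> wlt u w.
Proof.
elim: v u w => [|b v IH] [|a u] [|c w]; rewrite ?wltE //.
- by case: a; case: c.
- by case: b.
- by case: b; case: c; rewrite ?wltE.
- by case: a; case: b; rewrite ?wltE.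
by case: a; case: b; case: c; rewrite ?wltE // => h1 h2;
  [exact: (IH _ _ h2 h1)|exact: (IH _ _ h1 h2)].
Qed.

Lemma wlt_total u v : [\/ u = v, wlt u v | wlt v u].
Proof.
elim: u v => [|a u IH] [|b v].
- by constructor 1.
- by case: b; rewrite !wltE; [constructor 2|constructor 3].
- by case: a; rewrite !wltE; [constructor 3|constructor 2].
case: a; case: b; rewrite ?wltE; try by [constructor 2|constructor 3].
- by case: (IH v) => [->|h|h]; [constructor 1|constructor 3|constructor 2].
- by case: (IH v) => [->|h|h]; [constructor 1|constructor 2|constructor 3].
Qed.

Lemma wlt_asym u v : wlt u v -> wlt v u -> False.
Proof. by move=> h1 h2; have := wlt_trans h1 h2; rewrite wlt_irr. Qed.

Lemma wltNge u v : ~~ wlt u v -> u = v \/ wlt v u.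
Proof. by case: (wlt_total u v) => [->|->|h]; [left| |right]. Qed.

Lemma wlt_cat p u v :
  wlt (p ++ u) (p ++ v) = if par p then wlt v u else wlt u v.
Proof. by elim: p u v => [|[] p IH] u v //=; rewrite wltE IH; case: (par p). Qed.

(** Words with prefix [p] form an interval: [Y] must agree with [p] letter by letter, and a letter
    [true] swaps the two bounds. *)
Lemma cylinder p A B Y :
  wlt (p ++ A) Y -> wlt Y (p ++ B) -> exists Y1, Y = p ++ Y1.
Proof.
elim: p A B Y => [|a p IH] A B [|y Y]; try by [exists [::]|exists (y :: Y)].
- by rewrite /= !wltE; case: a.
by case: a; case: y; rewrite /= ?wltE // => h1 h2;
  [have [Y1 ->] := IH _ _ _ h2 h1|have [Y1 ->] := IH _ _ _ h1 h2]; exists Y1.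
Qed.

Lemma prefix_or_diff (U W : word) :
  [\/ exists X, W = U ++ X, exists X, U = W ++ X |
      exists p x U' W', U = p ++ x :: U' /\ W = p ++ ~~ x :: W'].
Proof.
elim: U W => [|a U IH] W; first by constructor 1; exists W.
case: W => [|b W]; first by constructor 2; exists (a :: U).
have [->|ne] := eqVneq b (~~ a).
  by constructor 3; exists [::], a, U, W.
have -> : b = a by move: ne; case: a; case: b.
case: (IH W) => [[X ->]|[X ->]|[p [x [U' [W' [-> ->]]]]]].
- by constructor 1; exists X.
- by constructor 2; exists X.
- by constructor 3; exists (a :: p), x, U', W'.
Qed.

Lemma wlt_diff p x U W :
  wlt (p ++ x :: U) (p ++ ~~ x :: W) = ~~ (par p (+) x).
Proof. by rewrite wlt_cat; case: (par p); case: x. Qed.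

Lemma wlt_diff1 p U W : wlt (p ++ par p :: U) (p ++ ~~ par p :: W).
Proof. by rewrite wlt_diff addbb. Qed.

Lemma wlt_ext p x U : wlt p (p ++ x :: U) = par p (+) x.
Proof. by rewrite -{1}[p]cats0 wlt_cat /=; case: (par p); case: x. Qed.

Lemma ext_wlt p x U : wlt (p ++ x :: U) p = ~~ (par p (+) x).
Proof. by rewrite -{2}[p]cats0 wlt_cat /=; case: (par p); case: x. Qed.

Lemma wlt_o p U : wlt p (p ++ ~~ par p :: U).
Proof. by rewrite wlt_ext addbN addbb. Qed.

Lemma wlt_e p U : wlt (p ++ par p :: U) p.
Proof. by rewrite ext_wlt addbb. Qed.

Lemma wlt_ee p U W : wlt (p ++ par p :: U) (p ++ par p :: W) = wlt U W.
Proof. by rewrite wlt_cat; case: (par p); rewrite /= wltE. Qed.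

Lemma wlt_oo p U W : wlt (p ++ ~~ par p :: U) (p ++ ~~ par p :: W) = wlt W U.
Proof. by rewrite wlt_cat; case: (par p); rewrite /= wltE. Qed.

Lemma bool_eN (x b : bool) : x = b \/ x = ~~ b.
Proof. by case: x; case: b; auto. Qed.

(** An inequality is decided either at a differing letter, and then survives all extensions, or by
    the parity of the shorter word. *)
Lemma cmpP U W : wlt U W ->
  [\/ forall X Y, wlt (U ++ X) (W ++ Y),
      exists W', W = U ++ ~~ par U :: W'
    | exists U', U = W ++ par W :: U'].
Proof.
case: (prefix_or_diff U W) => [[[|x X] ->]|[[|x X] ->]|[p [x [U' [W' [-> ->]]]]]].
- by rewrite cats0 wlt_irr.
- rewrite wlt_ext => h; constructor 2; exists X.
  by case: (par U) x h => -[].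
- by rewrite cats0 wlt_irr.
- rewrite ext_wlt => h; constructor 3; exists X.
  by case: (par W) x h => -[].
- by rewrite wlt_diff => h; constructor 1 => X Y; rewrite -!catA /= wlt_diff.
Qed.

(* Appending the letter [par V] (below: [e]) to [V] gives an even word, appending
   [~~ par V] (below: [o]) an odd one. *)
Lemma between V A B Y :
  wlt (V ++ par V :: A) Y -> wlt Y (V ++ ~~ par V :: B) ->
  [\/ Y = V, exists2 Y1, Y = V ++ par V :: Y1 & wlt A Y1
    | exists2 Y1, Y = V ++ ~~ par V :: Y1 & wlt B Y1].
Proof.
move=> h1 h2; have [[|y Y1] eY] := cylinder h1 h2; subst Y.
  by constructor 1; rewrite cats0.
have [ey|ey] := bool_eN y (par V); subst y.
- by constructor 2; exists Y1 => //; rewrite wlt_ee in h1.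
- by constructor 3; exists Y1 => //; rewrite wlt_oo in h2.
Qed.

Lemma between_o U A Y :
  wlt U Y -> wlt Y (U ++ ~~ par U :: A) ->
  exists2 Y1, Y = U ++ ~~ par U :: Y1 & wlt A Y1.
Proof.
move=> h1 h2.
have [eY|[Y1 eY _]|] // := between (wlt_trans (wlt_e U A) h1) h2; subst Y.
- by rewrite wlt_irr in h1.
- by case: (wlt_asym h1 (wlt_e U Y1)).
Qed.

Lemma between_e U A Y :
  wlt (U ++ par U :: A) Y -> wlt Y U ->
  exists2 Y1, Y = U ++ par U :: Y1 & wlt A Y1.
Proof.
move=> h1 h2.
have [eY|//|[Y1 eY _]] := between h1 (wlt_trans h2 (wlt_o U A)); subst Y.
- by rewrite wlt_irr in h2.
- by case: (wlt_asym h2 (wlt_o U Y1)).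
Qed.

(* For an even [g], the words above [g g g g...] form an up-set. *)
Lemma even_down g X Y : g <> [::] -> par g = false ->
  wlt X Y -> wlt Y (g ++ Y) -> wlt X (g ++ X).
Proof.
move=> g0 eg; have [k] := ubnP (size X); elim: k X Y => // k IH X Y szX lXY lY.
have [eX|//|lX] := wlt_total X (g ++ X).
  by have := congr1 size eX; rewrite size_cat; case: (g) g0 => //= a l _; lia.
(* Here [g ++ X] lies below [X], so [X] and [Y] both start with the even [g]; cancelling it gives a
   shorter counterexample. *)
have [X1 eX] := cylinder lX (wlt_trans lXY lY).
have [Y1 eY] := cylinder (wlt_trans lX lXY) lY.
have szg : 0 < size g by case: (g) g0.
have h1 : wlt X1 Y1 by move: lXY; rewrite eX eY wlt_cat eg.
have h2 : wlt Y1 (g ++ Y1) by move: lY; rewrite {1}eY wlt_cat eg eY.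
have h3 : wlt (g ++ X1) X1 by move: lX; rewrite {2}eX wlt_cat eg eX.
have szX1 : size X1 < k by move: szX; rewrite eX size_cat; lia.
by case: (wlt_asym h3 (IH _ _ szX1 h1 h2)).
Qed.

(* Period doubling: a square of an odd word has no maximal even extension. *)
Lemma no_doubling a b Z : par a -> par b -> a ++ b = b ++ a ->
  wlt (a ++ Z) Z -> wlt (b ++ Z) Z -> ~ wlt Z (a ++ b ++ Z).
Proof.
move=> pa pb com; have [k] := ubnP (size Z); elim: k Z => // k IH Z szZ la lb lab.
(* [Z] starts with both [a b] and [b a]; removing this common even factor gives the shorter
   counterexample [Z3]. *)
have [Z1 e1] := cylinder la lab.
have la1 : wlt Z1 Z by move: la; rewrite {2}e1 wlt_cat pa.
have lb1 : wlt (b ++ Z) Z1 by move: lab; rewrite {1}e1 wlt_cat pa.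
have lba : wlt Z (b ++ a ++ Z) by rewrite catA -com -catA.
have [Z2 e2] := cylinder lb lba.
have [Z3 e3] : exists Z3, Z1 = b ++ Z3.
  by apply: (cylinder lb1 (B := Z2)); rewrite -e2.
have eZ : Z = a ++ b ++ Z3 by rewrite {1}e1 e3.
have eZ' : Z = b ++ a ++ Z3 by rewrite eZ catA com catA.
have sza : 0 < size a by case: (a) pa.
have h1 : wlt (b ++ Z3) (a ++ b ++ Z3).
  by move: la; rewrite eZ wlt_cat pa.
have h2 : wlt (a ++ Z3) (b ++ a ++ Z3).
  by move: lb; rewrite eZ' wlt_cat pb.
apply: (IH Z3).
- by move: szZ; rewrite eZ !size_cat; lia.
- by move: h1; rewrite catA com -catA wlt_cat pb.
- by move: h2; rewrite catA -com -catA wlt_cat pa.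
- by move: lab; rewrite {1}eZ !wlt_cat pa pb eZ.
Qed.

(** * Shift-maximal words *)

Fixpoint allsuf (p : pred word) (X : word) : bool :=
  p X && (if X is _ :: X' then allsuf p X' else true).

Lemma allsufP (p : pred word) X :
  reflect (forall A B, X = A ++ B -> p B) (allsuf p X).
Proof.
apply: (iffP idP) => [|h].
  elim: X => [|x X IH] /=; first by rewrite andbT => pX [|//] [].
  by move=> /andP[pX /IH h] [|a A] B /=; [move=> <-|move=> [_ /h]].
elim: X h => [|x X IH] h /=; first by rewrite (h [::]).
by rewrite (h [::]) // IH // => A B eX; apply: (h (x :: A)); rewrite eX.
Qed.

Lemma allsuf_suf (p : pred word) A B : allsuf p (A ++ B) -> allsuf p B.
Proof.
by move=> /allsufP h; apply/allsufP => A1 B1 e; apply: (h (A ++ A1)); rewrite e catA.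
Qed.

Lemma allsuf_self (p : pred word) X : allsuf p X -> p X.
Proof. by move=> /allsufP h; apply: (h [::]). Qed.

Lemma longest_failing (p : pred word) X : ~~ allsuf p X ->
  exists A B, [/\ X = A ++ B, ~~ p B &
    forall A1 A2, A = A1 ++ A2 -> A2 <> [::] -> p (A2 ++ B)].
Proof.
elim: X => [|x X IH] /=.
  by rewrite andbT => h; exists [::], [::]; split=> // -[|//] [|].
rewrite negb_and; have [pX /= /IH [A [B [eX pB h]]]|npX _] := boolP (p (x :: X)).
  exists (x :: A), B; split=> [||[|a A1] A2 /=]; rewrite ?eX //.
    by move=> <- _; rewrite /= -eX.
  by move=> [_ e]; apply: h e.
by exists [::], (x :: X); split=> // -[|//] [|].
Qed.

Lemma cat_cons_split (V : word) x Z A B : V ++ x :: Z = A ++ B ->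
  (exists V', V = A ++ V' /\ B = V' ++ x :: Z) \/
  (exists A', A = V ++ x :: A' /\ Z = A' ++ B).
Proof.
elim: V A => [|v V IH] [|a A] //=.
- by move=> <-; left; exists [::].
- by move=> [<- ->]; right; exists A.
- by move=> <-; left; exists (v :: V).
move=> [<- /IH [[V' [-> ->]]|[A' [-> ->]]]]; [left|right].
  by exists V'.
by exists A'.
Qed.

Definition shift_max (w : word) : Prop :=
  forall A B, w = A ++ B -> A <> [::] -> wlt B w.

(** A proper suffix that no letter separates from [V] is a border, that is, also a prefix; as it
    lies below [V], the next letter of [V] makes it odd. *)
Lemma shift_max_border V A V' : shift_max V -> V = A ++ V' -> A <> [::] ->
  (forall X Y, wlt (V' ++ X) (V ++ Y)) \/ exists r, V = V' ++ ~~ par V' :: r.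
Proof.
move=> mV eV A0; case: (cmpP (mV _ _ eV A0)) => [|[r ->]|[U' eV']].
- by left.
- by right; exists r.
- have := congr1 size eV; have := congr1 size eV'; rewrite !size_cat /=.
  by case: (A) A0 => //= a l _; lia.
Qed.

Lemma suffix_lt_pref V A r W : shift_max V -> V = A ++ r -> A <> [::] ->
  wlt r (V ++ W).
Proof.
move=> mV eV A0; case: (shift_max_border mV eV A0) => [/(_ [::])|[r' ->]].
  by rewrite cats0; apply.
by rewrite -catA /=; apply: wlt_o.
Qed.

(* The condition on [B] for the suffixes of [V x B] starting inside [V] to lie
   below [V], when [V] is shift-maximal. *)
Definition tail_bound (x : bool) (V B : word) : Prop := forall A V' r,
  A <> [::] -> V = A ++ V' -> V = V' ++ ~~ par V' :: r -> x = ~~ par V' -> wlt r B.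

Lemma tail_bound_pref x V W : shift_max V -> tail_bound x V (V ++ W).
Proof.
move=> mV A V' r _ _ e _; apply: (suffix_lt_pref (A := rcons V' (~~ par V'))) => //.
  by rewrite cat_rcons.
by case: V' {e}.
Qed.

(** If [V'] is a border and [x] makes it odd, cancelling this odd prefix reverses the order and
    leaves the tail bound [r < B]. *)
Lemma junction x V A V' B : shift_max V -> V = A ++ V' -> A <> [::] ->
  tail_bound x V B ->
  wlt (V' ++ x :: B) V.
Proof.
move=> mV eV A0 lb; case: (shift_max_border mV eV A0) => [/(_ (x :: B) [::])|[r e]].
  by rewrite cats0.
have [ex|ex] := bool_eN x (par V'); rewrite ex e.
  exact: wlt_diff1.
by rewrite wlt_oo; apply: (lb A V').
Qed.

(** Among the suffixes starting inside [V], only borders need a condition, obtained by cancelling an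
    odd prefix. Converses are [shift_max_ext_suf] and [shift_max_ext_lb]. *)
Lemma shift_max_extI x V Z : shift_max V ->
  (forall A B, Z = A ++ B -> wlt B (V ++ x :: Z)) ->
  (forall A V' r, A <> [::] -> V = A ++ V' -> V = V' ++ ~~ par V' :: r ->
     x = ~~ par V' -> wlt (r ++ x :: Z) Z) ->
  shift_max (V ++ x :: Z).
Proof.
move=> mV sZ bV A B e A0.
case: (cat_cons_split e) => [[V' [eV ->]]|[A' [_ /sZ]]] //.
case: (shift_max_border mV eV A0) => [//|[r eV']].
have [ex|ex] := bool_eN x (par V').
  by rewrite [in X in wlt _ X]eV' -catA ex; apply: wlt_diff1.
rewrite [in X in wlt _ X]eV' -catA /= {1}ex wlt_oo.
exact: bV eV eV' ex.
Qed.

Lemma shift_max_ext_lb x V Z A V' r : shift_max (V ++ x :: Z) -> A <> [::] ->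
  V = A ++ V' ->
  V = V' ++ ~~ par V' :: r -> x = ~~ par V' -> wlt (r ++ x :: Z) Z.
Proof.
move=> mZ A0 eV eV' ex.
have := mZ A (V' ++ x :: Z); rewrite {1}eV -catA => /(_ erefl A0).
by rewrite [in X in wlt _ X]eV' -catA /= {1}ex wlt_oo.
Qed.

Lemma shift_max_ext_suf x V Z A B : shift_max (V ++ x :: Z) -> Z = A ++ B ->
  wlt B (V ++ x :: Z).
Proof.
move=> mZ eZ; apply: (mZ (V ++ x :: A)); first by rewrite eZ -catA.
by case: (V).
Qed.

(** A suffix [V'] above [V] would be a border continued in [V] by its even letter; one of the two
    extensions continues the suffix by its odd letter and so is not maximal. *)
Lemma shift_max_common V Z Z' : shift_max (V ++ par V :: Z) ->
  shift_max (V ++ ~~ par V :: Z') -> shift_max V.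
Proof.
move=> m1 m2 A V' eV A0.
case: (wlt_total V' V) => [e||h] //.
  by have := congr1 size eV; rewrite size_cat e; case: (A) A0 => //= a l _; lia.
have sz : size V' < size V.
  by rewrite eV size_cat; case: (A) A0 => //= a l _; lia.
case: (cmpP h) => [h'|[W' e]|[U' e]].
- have h1 : wlt (V' ++ par V :: Z) (V ++ par V :: Z).
    by apply: m1 A0; rewrite [in X in X ++ _ = _]eV -catA.
  by case: (wlt_asym h1 (h' _ _)).
- by move: sz; rewrite e size_cat /=; lia.
- have [ex|ex] := bool_eN (par V) (par V').
    have h2 : wlt (V' ++ ~~ par V :: Z') (V ++ ~~ par V :: Z').
      by apply: m2 A0; rewrite [in X in X ++ _ = _]eV -catA.
    move: h2; rewrite ex [in X in wlt _ X]e -catA /= => h2.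
    by case: (wlt_asym h2 (wlt_diff1 _ _ _)).
  have h2 : wlt (V' ++ par V :: Z) (V ++ par V :: Z).
    by apply: m1 A0; rewrite [in X in X ++ _ = _]eV -catA.
  move: h2; rewrite ex [in X in wlt _ X]e -catA /= => h2.
  by case: (wlt_asym h2 (wlt_diff1 _ _ _)).
Qed.

(* [good V Y] says that [Y] lies below the periodic word [V e V e V e ...]. *)
Definition good (V Y : word) : bool := wlt Y (V ++ par V :: Y).

Definition below (V X : word) : bool := allsuf (fun Y => wlt Y V) X.

Lemma good_lt V Y : good V Y -> wlt Y V.
Proof. by move=> h; apply: wlt_trans h (wlt_e _ _). Qed.

Lemma good_down V X Y : wlt X Y -> good V Y -> good V X.
Proof.
rewrite /good -!cat_rcons; apply: even_down; first by case: (V).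
by rewrite par_rcons addbb.
Qed.

Lemma good_e V Y : good V (V ++ par V :: Y) = good V Y.
Proof. by rewrite {1}/good wlt_ee. Qed.

Lemma ngoodP V Y : ~~ good V Y -> wlt (V ++ par V :: Y) Y.
Proof.
move=> /wltNge [e|//].
by have := congr1 size e; rewrite size_cat /=; lia.
Qed.

(** A violation lies between [V e X] and [V], hence starts with [V e]; removing this block leaves a
    shorter violation. *)
Lemma below_good V X : below V X -> good V X.
Proof.
have [k] := ubnP (size X); elim: k X => // k IH X szX bX.
apply: contraT => /ngoodP h.
have [Y1 e _] := between_e h (allsuf_self bX).
have gY : good V Y1.
  apply: IH; first by move: szX; rewrite e size_cat /=; lia.
  by apply: (allsuf_suf (A := rcons V (par V))); rewrite cat_rcons -e.
by move: h; rewrite e wlt_ee => /(wlt_asym gY).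
Qed.

Lemma belowP V X : reflect (forall A B, X = A ++ B -> wlt B V) (below V X).
Proof. exact: allsufP. Qed.

(** The critical case is [V = B z r] with [B z] odd: the order is reversed, and the suffix [r] of
    [V] lies below [V W]. *)
Lemma lt_join V B z W : shift_max V -> wlt B V -> wlt (B ++ z :: V ++ W) V.
Proof.
move=> mV h; case: (cmpP h) => [/(_ (z :: V ++ W) [::])|[r e]|[U' ->]].
- by rewrite cats0.
- have [ez|ez] := bool_eN z (par B); rewrite ez [in X in wlt _ X]e.
    exact: wlt_diff1.
  rewrite wlt_oo; apply: (suffix_lt_pref (A := rcons B (~~ par B))) => //.
    by rewrite cat_rcons.
  by case: (B).
- by rewrite -catA /=; apply: wlt_e.
Qed.

Lemma below_join V B z W : shift_max V -> below V B -> below V (V ++ W) ->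
  below V (B ++ z :: V ++ W).
Proof.
move=> mV bB bX; apply/belowP => A B' e.
case: (cat_cons_split e) => [[V' [eB ->]]|[A' [_ eX]]].
  by apply: lt_join => //; move/belowP: bB => /(_ _ _ eB).
by move/belowP: bX => /(_ _ _ eX).
Qed.

Lemma below_e V X : shift_max V -> tail_bound (par V) V X -> below V X ->
  below V (V ++ par V :: X).
Proof.
move=> mV lb bX; apply/belowP => A B e.
case: (cat_cons_split e) => [[V' [eV ->]]|[A' [_ eX]]].
  case: A eV {e} => [|a A] eV; first by rewrite -[V']/([::] ++ V') -eV; apply: wlt_e.
  exact: junction eV _ lb.
by move/belowP: bX => /(_ _ _ eX).
Qed.

Lemma shift_max_e_below V Z : shift_max (V ++ par V :: Z) -> below V Z.
Proof.
by move=> mZ; apply/belowP => A B e; apply: wlt_trans (shift_max_ext_suf mZ e) (wlt_e _ _).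
Qed.

(** The critical case for a suffix [B] of [P0] is [V = B p U'] with [B p] even: it would put [V W]
    below the proper suffix [U'] of [V]. *)
Lemma tail_below V W P0 p : shift_max V ->
  (forall A1 A2, rcons P0 p = A1 ++ A2 -> A2 <> [::] -> wlt (A2 ++ V ++ W) V) ->
  (forall Q, P0 <> Q ++ V) -> below V P0.
Proof.
move=> mV h nV; apply/belowP => A B eP.
have h1 : wlt (B ++ p :: V ++ W) V.
  by rewrite -cat_rcons; apply: (h A); [rewrite eP rcons_cat|case: (B)].
case: (wlt_total B V) => [eB|//|h2]; first by case: (nV A); rewrite -eB.
case: (cmpP h2) => [/(_ [::] (p :: V ++ W))|[W' eB]|[U' eV]].
- by rewrite cats0 => h3; case: (wlt_asym h1 h3).
- by move: h1; rewrite eB -catA /= => h1; case: (wlt_asym h1 (wlt_o _ _)).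
have [ep|ep] := bool_eN p (par B).
  move: h1; rewrite ep [in X in wlt _ X]eV wlt_ee => h1.
  case: (wlt_asym h1 (suffix_lt_pref (A := rcons B (par B)) _ mV _ _)).
    by rewrite cat_rcons.
  by case: (B).
move: h1; rewrite ep [in X in wlt _ X]eV => h1.
by case: (wlt_asym h1 (wlt_diff1 _ _ _)).
Qed.

Lemma tail_bound_head V P0 p W Z : shift_max V -> shift_max (V ++ par V :: Z) ->
  wlt Z (V ++ W) ->
  Z = P0 ++ p :: V ++ W \/ wlt Z (P0 ++ p :: V ++ W) -> tail_bound (par V) V P0.
Proof.
move=> mV mZ lZ leZ A V' r A0 eV eV' ex.
have h1 := shift_max_ext_lb mZ A0 eV eV' ex.
have h2 : wlt (r ++ par V :: Z) (P0 ++ p :: V ++ W).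
  by case: leZ => [<-|] //; apply: wlt_trans.
have pr : par V = ~~ par r.
  have := congr1 par eV'; rewrite par_cat /= ex addbA.
  by case: (par V'); case: (par r).
have h0 : wlt r (P0 ++ p :: V ++ W) by apply: wlt_trans h2; rewrite pr; apply: wlt_o.
case: (wlt_total r P0) => [e|//|h].
  move: h2; rewrite e pr e; have [->|->] := bool_eN p (par P0) => h2.
    by case: (wlt_asym h2 (wlt_diff1 _ _ _)).
  by move: h2; rewrite wlt_oo => h2; case: (wlt_asym h2 lZ).
case: (cmpP h) => [/(_ (p :: V ++ W) [::])|[W' e]|[U' e]].
- by rewrite cats0 => h3; case: (wlt_asym h0 h3).
- move: h0; rewrite e; have [->|->] := bool_eN p (par P0) => h0.
    by case: (wlt_asym h0 (wlt_diff1 _ _ _)).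
  move: h0; rewrite wlt_oo => h0.
  case: (wlt_asym h0 (suffix_lt_pref (A := V' ++ ~~ par V' :: rcons P0 (~~ par P0)) _ mV _ _)).
    by rewrite -catA /= cat_rcons -e.
  by case: (V').
- by move: h0; rewrite e -catA /= => h0; case: (wlt_asym h0 (wlt_e _ _)).
Qed.

(** * Maximal extensions of an even word *)

Lemma max_seq (l : seq word) : l <> [::] ->
  exists2 X, X \in l & forall Y, Y \in l -> ~~ wlt X Y.
Proof.
elim: l => // a l IH _; have [->|ne] := eqVneq l [::].
  by exists a; rewrite ?mem_head // => Y; rewrite inE => /eqP ->; rewrite wlt_irr.
have [X Xl hX] := IH (elimN eqP ne).
have [h|h] := boolP (wlt X a).
  exists a; first exact: mem_head.
  move=> Y; rewrite inE => /predU1P[->|/hX]; first by rewrite wlt_irr.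
  by apply: contra; apply: wlt_trans.
exists X; first by rewrite inE Xl orbT.
by move=> Y; rewrite inE => /predU1P[->|/hX].
Qed.

Lemma max_word (p : pred word) X0 : p X0 ->
  exists X, [/\ size X = size X0, p X, X0 = X \/ wlt X0 X &
    forall Y, size Y = size X0 -> p Y -> ~~ wlt X Y].
Proof.
move=> p0.
pose l := [seq X <- [seq tval t | t : (size X0).-tuple bool] | p X].
have memW Y : size Y = size X0 -> p Y -> Y \in l.
  move=> sY pY; rewrite mem_filter pY; apply/mapP.
  by exists (Tuple (introT eqP sY)); rewrite ?mem_enum.
case: (@max_seq l) => [|X].
  by have := memW X0 erefl p0; case: (l).
rewrite mem_filter => /andP[pX /mapP[t _ eX]] hX; exists X; split=> //.
- by rewrite eX size_tuple.
- by have := hX _ (memW X0 erefl p0) => /wltNge [->|]; [left|right].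
- by move=> Y sY pY; apply: hX; apply: memW.
Qed.

(** Only when [Z] extends [B z] with [B z] even does the comparison reach [X], and then it is with a
    suffix of [Z]. *)
Lemma ext_gt Z B z X : wlt Z B ->
  (forall A Z8, Z = A ++ Z8 -> wlt Z8 X) -> wlt Z (B ++ z :: X).
Proof.
move=> h hX; case: (cmpP h) => [/(_ [::])|[B' ->]|[Z' eZ]].
- by rewrite cats0; apply.
- by rewrite -catA /=; apply: wlt_o.
- have [->|->] := bool_eN z (par B); last by rewrite eZ; apply: wlt_diff1.
  rewrite eZ wlt_ee; apply: (hX (rcons B (par B))).
  by rewrite cat_rcons.
Qed.

(** The case that the choice of the cell excludes, through [not_bigger]. *)
Definition bigger (V Z : word) : Prop :=
  exists Z', [/\ size Z' = size Z, wlt Z Z' & shift_max (V ++ par V :: Z')].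

(* In the largest [M] having all its suffixes below [V], a longest suffix
   [Y = V e B] above [V e M] would make [B o V e P0] larger than [M = P0 p Y]. *)
Lemma below_bigger V Z Z1 : shift_max V -> shift_max (V ++ par V :: Z) ->
  below V Z1 ->
  size Z1 = size Z -> wlt Z Z1 -> bigger V Z.
Proof.
move=> mV mZ b1 s1 l1.
have [M [sM bM leM maxM]] := max_word b1.
have lM : wlt Z M by case: leM => [<-|/(wlt_trans l1)].
exists M; split=> //; first by rewrite sM.
suff sufM : allsuf (fun Y => wlt Y (V ++ par V :: M)) M.
  apply: shift_max_extI => // [A B e|A V' r A0 eV eV' ex].
    by move/allsufP: sufM => /(_ _ _ e).
  have h := shift_max_ext_lb mZ A0 eV eV' ex.
  have pr : par V = ~~ par r.
    have := congr1 par eV'; rewrite par_cat /= ex.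
    by case: (par V'); case: (par r).
  (* [r e] is odd, so replacing [Z] by the larger [M] behind it lowers the word. *)
  apply: wlt_trans (wlt_trans h lM).
  by rewrite pr wlt_oo.
apply: contraT => /longest_failing [P [Y [eM nY hY]]].
have gM := below_good bM.
have lY : wlt (V ++ par V :: M) Y.
  case/wltNge: nY => // e; have := congr1 size eM; rewrite e !size_cat /=.
  by lia.
have YV : wlt Y V by move/belowP: bM => /(_ _ _ eM).
have [B eY lB] := between_e lY YV.
case/lastP: P eM hY => [|P0 p] eM hY.
  by case: (wlt_asym lY); rewrite -[Y]/([::] ++ Y) -eM.
have eM' : M = P0 ++ p :: Y by rewrite eM cat_rcons.
(* Otherwise [p] is [e], and the longer suffix [V e Y] lies below [V e M], so that
   [Y < M < V e M]. *)
have nP Q : P0 <> Q ++ V.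
  move=> eP; have h : wlt (V ++ p :: Y) V.
    by move/belowP: bM => /(_ Q); apply; rewrite eM' eP -catA.
  have ep : p = par V by move: h; rewrite ext_wlt; case: (par V); case: (p).
  have := hY Q (rcons V p); rewrite eP -rcons_cat => /(_ erefl).
  rewrite cat_rcons ep wlt_ee => h'; apply: (wlt_asym lY).
  by apply: wlt_trans (h' _) gM; case: (V).
have bP : below V P0.
  apply: (@tail_below _ (par V :: B) _ p) => // A1 A2 e _; rewrite -eY.
  by move/belowP: bM => /(_ A1); apply; rewrite eM e catA.
have lZY : wlt Z (V ++ par V :: B).
  by rewrite -eY; apply: wlt_trans lM (wlt_trans gM lY).
have lbP : tail_bound (par V) V P0.
  by apply: (tail_bound_head (p := p) mV mZ lZY); right; rewrite -eY -eM'.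
have bX := below_e mV lbP bP.
have bB : below V B.
  apply: (allsuf_suf (A := rcons P0 p ++ rcons V (par V))).
  by rewrite -catA !cat_rcons -eY -eM'.
have sN : size (B ++ ~~ par B :: V ++ par V :: P0) = size Z1.
  by rewrite -sM eM' eY !size_cat /= !size_cat /=; clear; lia.
have := maxM _ sN (below_join _ mV bB bX).
by rewrite (wlt_trans lB (wlt_o _ _)).
Qed.

(** * Removing large suffixes *)

(* For [W = V] this is the star product of words, [V] being read as [f]. *)
Fixpoint sub (V bs W : word) : word :=
  if bs is b :: bs' then V ++ (b (+) par V) :: sub V bs' W else W.

Lemma size_sub V bs W : size (sub V bs W) = size bs * (size V).+1 + size W.
Proof. by elim: bs => //= b bs IH; rewrite size_cat /= IH mulSn; clear; lia. Qed.

Lemma sub_nil_cat V bs W : sub V bs W = sub V bs [::] ++ W.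
Proof. by elim: bs => //= b bs ->; rewrite -catA. Qed.

Lemma bad_cases V Z Y : ~~ good V Y -> wlt Y (V ++ ~~ par V :: Z) ->
  [\/ Y = V, exists2 Y1, Y = V ++ par V :: Y1 & ~~ good V Y1
    | exists2 B, Y = V ++ ~~ par V :: B & wlt Z B].
Proof.
move=> bY lY; have [->|[Y1 e _]|[B e lB]] := between (ngoodP bY) lY.
- by constructor 1.
- by constructor 2; exists Y1 => //; rewrite -good_e -e.
- by constructor 3; exists B.
Qed.

Lemma bad_pref V Z Y : ~~ good V Y -> wlt Y (V ++ ~~ par V :: Z) ->
  exists W, Y = V ++ W.
Proof.
move=> bY /(bad_cases bY) [->|[Y1 -> _]|[B -> _]].
- by exists [::]; rewrite cats0.
- by eexists.
- by eexists.
Qed.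

(** Blocks are peeled off one by one: behind [V e] the rest is still not good, behind [V o] it lies
    above [Z]. Peeling stops at [V] or at the first good rest. *)
Lemma bad_blocks V Z Y : ~~ good V Y ->
  allsuf (fun B => wlt B (V ++ ~~ par V :: Z)) Y ->
  exists bs, Y = sub V bs V \/
    exists B, [/\ bs <> [::], Y = sub V bs B, good V B & wlt Z B].
Proof.
have [k] := ubnP (size Y); elim: k Y => // k IH Y szY bY sY.
case: (bad_cases bY (allsuf_self sY)) => [->|[Y1 e bY1]|[B e lB]].
- by exists [::]; left.
- have sY1 : allsuf (fun B => wlt B (V ++ ~~ par V :: Z)) Y1.
    by apply: (allsuf_suf (A := rcons V (par V))); rewrite cat_rcons -e.
  move: szY; rewrite e size_cat /= => szY.
  case: (IH Y1) => // [|bs [e1|[B [bs0 e1 gB lB]]]]; first by clear -szY; lia.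
    by exists (false :: bs); left; rewrite /= -e1.
  by exists (false :: bs); right; exists B; split; rewrite //= -e1.
- have [gB|bB] := boolP (good V B).
    by exists [:: true]; right; exists B.
  have sB : allsuf (fun B => wlt B (V ++ ~~ par V :: Z)) B.
    by apply: (allsuf_suf (A := rcons V (~~ par V))); rewrite cat_rcons -e.
  move: szY; rewrite e size_cat /= => szY.
  case: (IH B) => // [|bs [e1|[B' [bs0 e1 gB' lB']]]]; first by clear -szY; lia.
    by exists (true :: bs); left; rewrite /= -e1.
  by exists (true :: bs); right; exists B'; split; rewrite //= -e1.
Qed.

(** A violation starts with [V e]. Either this block lies inside [B] and can be removed from both
    words, or what follows it is a suffix of [V W], hence good. *)
Lemma good_join V B z W : shift_max V -> below V (V ++ W) -> good V B ->
  good V (B ++ z :: V ++ W).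
Proof.
move=> mV bX; have [k] := ubnP (size B); elim: k B => // k IH B szB gB.
apply: contraT => bad.
have [G e _] := between_e (ngoodP bad) (lt_join z W mV (good_lt gB)).
move: bad; rewrite e good_e; apply: contraNT => _.
move: (e); rewrite -(cat_rcons (par V)) => /cat_cons_split [[V' [eB ->]]|[A' [_ eX]]].
  apply: IH.
    by move: szB; rewrite eB size_cat size_rcons; clear; lia.
  by move: gB; rewrite eB cat_rcons good_e.
by apply: below_good; apply: (allsuf_suf (A := A')); rewrite -eX.
Qed.

(** The decreasing measure in [exists_below]. *)
Fixpoint nbad (V X : word) : nat :=
  ~~ good V X + (if X is _ :: X' then nbad V X' else 0).

Lemma nbad_suf V A B : nbad V B <= nbad V (A ++ B).
Proof. by elim: A => //= a A IH; apply: leq_trans IH (leq_addl _ _). Qed.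

Lemma nbad_below V X : below V X -> nbad V X = 0.
Proof.
elim: X => [|x X IH] bX /=; first by rewrite below_good.
by rewrite below_good // IH //; apply: (allsuf_suf (A := [:: x])).
Qed.

Lemma nbad_join V B z W : shift_max V -> below V (V ++ W) ->
  nbad V (B ++ z :: V ++ W) <= nbad V B.
Proof.
move=> mV bX.
have gj B' : ~~ good V (B' ++ z :: V ++ W) <= ~~ good V B'.
  by have [/(good_join z mV bX) -> //|_] := boolP (good V B'); apply: leq_b1.
elim: B => [|b B IH].
  have := gj [::]; rewrite [nbad _ ([::] ++ _)]/= (nbad_below bX) !addn0 => h.
  exact: leq_trans h (leq_addr _ _).
by apply: leq_add (gj (b :: B)) IH.
Qed.

Lemma head_gt Z P0 p Y : wlt Z (P0 ++ p :: Y) -> size P0 < size Z ->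
  (forall A Z8, Z = A ++ Z8 -> wlt Z8 Y) -> wlt Z P0.
Proof.
move=> h sz hY; case: (wlt_total Z P0) => [e|//|h'].
  by move: sz; rewrite e ltnn.
case: (cmpP h') => [/(_ (p :: Y) [::])|[Z8 e]|[U' e]].
- by rewrite cats0 => h''; case: (wlt_asym h h'').
- move: h; rewrite e; have [->|->] := bool_eN p (par P0) => h.
    by case: (wlt_asym h (wlt_diff1 _ _ _)).
  move: h; rewrite wlt_oo => h; case: (wlt_asym h (hY (rcons P0 (~~ par P0)) _ _)).
  by rewrite cat_rcons.
- by move: sz; rewrite e size_cat /=; clear; lia.
Qed.

(** Blocks [V e] serve as padding that restores the length of a rearranged word. *)
Lemma pow_e_facts V Z P0 k : shift_max V -> good V Z -> below V P0 ->
  tail_bound (par V) V P0 ->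
  wlt Z P0 ->
  [/\ below V (sub V (nseq k false) P0), tail_bound (par V) V (sub V (nseq k false) P0)
    & wlt Z (sub V (nseq k false) P0)].
Proof.
move=> mV gZ bP lbP lP; elim: k => [|k [IH1 IH2 IH3]] //=; split.
- exact: below_e.
- exact: tail_bound_pref.
- by apply: wlt_trans gZ _; rewrite wlt_ee.
Qed.

(* Induction on the number of suffixes that are not [good]: for the longest one
   [V x1 ... V xk B] of [Z' = P0 p V x1 ... V xk B], pass to [B false (V e)^k P0]. *)
Lemma exists_below V Z Z' : shift_max V -> shift_max (V ++ par V :: Z) ->
  size Z' = size Z ->
  wlt Z Z' -> good V Z' -> allsuf (fun B => wlt B (V ++ ~~ par V :: Z)) Z' ->
  exists Z'', [/\ size Z'' = size Z, wlt Z Z'' & below V Z''].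
Proof.
move=> mV mZ; have bZ := shift_max_e_below mZ; have gZ := below_good bZ.
have [k] := ubnP (nbad V Z'); elim: k Z' => // k IH Z' nk sZ' lZ' gZ' sufZ'.
have [all|] := boolP (allsuf (good V) Z').
  exists Z'; split=> //; apply/belowP => A B e.
  by apply: good_lt; move/allsufP: all => /(_ _ _ e).
case/longest_failing => P [Y [eZ' bY hY]].
have sufY : allsuf (fun B => wlt B (V ++ ~~ par V :: Z)) Y.
  by apply: (allsuf_suf (A := P)); rewrite -eZ'.
have [W eY] := bad_pref bY (allsuf_self sufY).
have lY A Z8 : Z = A ++ Z8 -> wlt Z8 Y.
  move=> e; have g8 : good V Z8.
    by apply: below_good; apply: (allsuf_suf (A := A)); rewrite -e.
  case: (wlt_total Z8 Y) => [e8|//|h]; first by rewrite -e8 g8 in bY.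
  by rewrite (good_down h g8) in bY.
case/lastP: P eZ' hY => [|P0 p] eZ' hY.
  by move: gZ'; rewrite eZ' (negbTE bY).
have eZ2 : Z' = P0 ++ p :: Y by rewrite eZ' cat_rcons.
have szP0 : size P0 < size Z.
  by rewrite -sZ' eZ2 size_cat /=; clear; lia.
have lP0 : wlt Z P0.
  by apply: (head_gt (p := p) (Y := Y)) => //; rewrite -eZ2.
have bP0 : below V P0.
  apply: (@tail_below _ W _ p) => // [A1 A2 e A20|Q eQ].
    by apply: good_lt; rewrite -eY; apply: hY e A20.
  have gpY : good V (V ++ p :: Y).
    by rewrite -cat_rcons; apply: (hY Q); [rewrite eQ rcons_cat|case: (V)].
  move: (gpY); have [->|->] := bool_eN p (par V).
    by rewrite good_e (negbTE bY).
  by move=> /good_lt /(wlt_asym (wlt_o _ _)).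
have lbP : tail_bound (par V) V P0.
  apply: (tail_bound_head (p := p) (W := W) mV mZ); first by rewrite -eY; apply: (lY [::]).
  by right; rewrite -eY -eZ2.
case: (bad_blocks bY sufY) => bs [eYs|[B [bs0 eYs gB lB]]].
  (* One extra block: the letter [p] and the final [V] of [Y] together have the length of a
     block. *)
  have [b1 _ l1] := pow_e_facts (size bs).+1 mV gZ bP0 lbP lP0.
  exists (sub V (nseq (size bs).+1 false) P0); split=> //.
  rewrite -sZ' eZ2 eYs size_cat /= size_cat /= !size_sub size_nseq.
  by clear; lia.
have [c ec] : exists c, size bs = c.+1 by case: (bs) bs0 => // b l _; exists (size l).
have [b1 _ l1] := pow_e_facts c mV gZ bP0 lbP lP0.
have [bX _ lX] := pow_e_facts c.+1 mV gZ bP0 lbP lP0.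
set X := sub V (nseq c false) P0 in b1 l1 bX lX.
have {}bX : below V (V ++ par V :: X) := bX.
have lX8 A Z8 : Z = A ++ Z8 -> wlt Z8 (V ++ par V :: X).
  move=> e; apply: wlt_trans (shift_max_ext_suf mZ e) _.
  by rewrite wlt_ee.
have eZB : Z' = (P0 ++ p :: sub V bs [::]) ++ B.
  by rewrite eZ2 eYs -catA /= -sub_nil_cat.
(* [Y] itself is not good, and [B] is a proper suffix of it. *)
have bs1 : nbad V B < nbad V Y.
  case: (bs) bs0 eYs => // b l _ eYs.
  have [y [Y' [eY' eB]]] : exists y Y', Y = y :: Y' /\ exists Q, Y' = Q ++ B.
    rewrite eYs /= sub_nil_cat; case: (V) => [|v V0].
      do 2 eexists; split=> //.
      by exists (sub [::] l [::]).
    do 2 eexists; split=> //.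
    by exists (V0 ++ (b (+) par (v :: V0)) :: sub (v :: V0) l [::]); rewrite -catA.
  have [Q eQ] := eB; move: bY; rewrite eY' eQ /= => ->.
  exact: nbad_suf.
(* [X] has [c] blocks, one less than [bs], since one [V e] is written out. The joining letter is
   arbitrary. *)
apply: (IH (B ++ false :: V ++ par V :: X)).
- apply: leq_trans (_ : (nbad V B).+1 <= _).
    by rewrite ltnS; apply: nbad_join.
  apply: leq_trans (bs1) _; rewrite -ltnS; apply: leq_trans nk.
  by rewrite ltnS eZ'; apply: nbad_suf.
- rewrite -sZ' eZ2 eYs !size_cat /= !size_cat /= !size_sub size_nseq ec.
  by clear; lia.
- exact: ext_gt lB lX8.
- exact: good_join.
- apply/allsufP => A B' e.
  case: (cat_cons_split e) => [[V' [eB ->]]|[A' [_ eX]]]; last first.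
    by move/belowP: bX => /(_ _ _ eX) h; apply: wlt_trans h (wlt_o _ _).
  have sV' : wlt V' (V ++ ~~ par V :: Z).
    by move/allsufP: sufZ' => /(_ ((P0 ++ p :: sub V bs [::]) ++ A) V'); apply; rewrite eZB eB -!catA.
  have [gV'|bV'] := boolP (good V V').
    have g := good_lt (good_join false mV bX gV').
    exact: wlt_trans g (wlt_o _ _).
  case: (bad_cases bV' sV') => [->|[Y1 -> _]|[B1 -> lB1]].
  + have [->|->] := bool_eN false (par V).
      exact: wlt_diff1.
    by rewrite wlt_oo; apply: (lX8 [::]).
  + by rewrite -catA /=; apply: wlt_diff1.
  + by rewrite -catA /= wlt_oo; apply: ext_gt lB1 lX8.
Qed.

(** If [Z'] is good, it can be rearranged to a larger tail behind [V e]. If not, it splits into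
    blocks; a good rest [B > Z'] would make [Z'] good by [good_down]. *)
Lemma bigger_or_star V Z Z' : shift_max (V ++ par V :: Z) ->
  shift_max (V ++ ~~ par V :: Z') ->
  size Z' = size Z -> wlt Z Z' -> bigger V Z \/ exists bs, Z' = sub V bs V.
Proof.
move=> mZ mZ' sZ' lZ; have mV := shift_max_common mZ mZ'.
(* The bound with [Z] is for [exists_below], the one with [Z'] for [bad_blocks]. *)
have suf Z1 : Z1 = Z \/ Z1 = Z' -> allsuf (fun B => wlt B (V ++ ~~ par V :: Z1)) Z'.
  move=> e1; apply/allsufP => A B e.
  have := shift_max_ext_suf mZ' e; case: e1 => -> // h; apply: wlt_trans h _.
  by rewrite wlt_oo.
have [gZ'|bZ'] := boolP (good V Z'); [left|right].
  have [Z1 [s1 l1 b1]] := exists_below mV mZ sZ' lZ gZ' (suf Z (or_introl erefl)).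
  exact: below_bigger b1 s1 l1.
have [bs [->|[B [bs0 e gB lB]]]] := bad_blocks bZ' (suf Z' (or_intror erefl)).
  by exists bs.
by have := good_down lB gB; rewrite (negbTE bZ').
Qed.

(** * Suffixes of a shift-maximal word behind its odd prefixes *)

Lemma max_odd_suffix V P0 r : V = P0 ++ r -> par P0 ->
  exists P G, [/\ V = P ++ G, par P &
    forall P' G', V = P' ++ G' -> par P' -> G' = G \/ wlt G' G].
Proof.
move=> eV p0.
pose l := [seq drop i V | i <- [seq i <- iota 0 (size V).+1 | par (take i V)]].
have meml P' G' : V = P' ++ G' -> par P' -> G' \in l.
  move=> e pP; apply/mapP; exists (size P').
    rewrite mem_filter mem_iota e take_size_cat // pP /= size_cat.
    by clear; lia.
  by rewrite e drop_size_cat.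
case: (@max_seq l) => [|G /mapP[i]].
  by have := meml _ _ eV p0; case: (l).
rewrite mem_filter => /andP[pi _] -> hG.
exists (take i V), (drop i V); split=> //; first by rewrite cat_take_drop.
move=> P' G' e pP'; have /wltNge [->|] := hG _ (meml _ _ e pP'); by [left|right].
Qed.

(* The witness is [G o' P0], where [G] is the largest suffix of [V] preceded by an
   odd prefix [P0 p], and [o'] makes [G o'] odd. *)
Lemma odd_suffix_word V A V' r Z : shift_max V -> shift_max (V ++ par V :: Z) ->
  A <> [::] -> V = A ++ V' -> V = V' ++ ~~ par V' :: r -> par V = par V' ->
  exists K, [/\ size K = size V, below V K, tail_bound (par V) V K &
    forall W, wlt (r ++ ~~ par V :: W) K].
Proof.
move=> mV mZ A0 eV eV' pVV'.
have eVr : V = rcons V' (~~ par V') ++ r by rewrite cat_rcons.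
have pr : par (rcons V' (~~ par V')) by rewrite par_rcons addbN addbb.
have [P [G [ePG oddP maxG]]] := max_odd_suffix eVr pr.
case/lastP: P ePG oddP => [|P0 p] // ePG oddP.
have eV0 : V = P0 ++ p :: G by rewrite ePG cat_rcons.
have pV : par V = ~~ par G by rewrite ePG par_cat oddP.
have pp : p = ~~ par P0 by move: oddP; rewrite par_rcons; case: (par P0); case: (p).
pose K := G ++ par V :: P0.
have leK s : s = G \/ wlt s G -> wlt s K.
  have h : wlt G K by rewrite /K pV wlt_o.
  by case=> [->|/wlt_trans]; [|apply].
have szG : size G < size V by rewrite eV0 size_cat /=; clear; lia.
have szP0 : size P0 < size V by rewrite eV0 size_cat /=; clear; lia.
have lP0V : wlt P0 V by rewrite eV0 pp wlt_o.
have suf_lt Q s : V = Q ++ s -> par Q -> wlt s V.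
  by move=> e pQ; apply: mV e _; case: (Q) pQ.
have GV : wlt G V := suf_lt _ _ ePG oddP.
(* A suffix [B] of [P0] above [V] forces [B p] even and [G = B p G2] with [G < G2]; the odd prefix
   [P0 p B p] then contradicts the choice of [G]. *)
have bP0 : below V P0.
  apply/belowP => P1 B eP0.
  case: (wlt_total B V) => [e|//|h].
    by move: szP0; rewrite eP0 e size_cat; clear; lia.
  case: P1 eP0 => [|x P1] eP0.
    by move: h; rewrite -[B]/([::] ++ B) -eP0 => /(wlt_asym lP0V).
  have eVB : V = (x :: P1) ++ B ++ p :: G by rewrite eV0 eP0 -catA.
  have h1 : wlt (B ++ p :: G) V by apply: mV eVB _.
  case: (cmpP h) => [/(_ [::] (p :: G))|[W' e]|[U' e]].
  + by rewrite cats0 => h2; case: (wlt_asym h1 h2).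
  + by move: szP0; rewrite eP0 e !size_cat; clear; lia.
  have [ep|ep] := bool_eN p (par B); last first.
    by move: h1; rewrite ep [in X in wlt _ X]e => /(wlt_asym (wlt_diff1 _ _ _)).
  have parB : par (rcons B p) = false by rewrite par_rcons ep addbb.
  have parx : par (x :: P1).
    by move: oddP; rewrite eP0 rcons_cat par_cat parB addbF.
  have lB : wlt (B ++ p :: G) G.
    case: (maxG _ _ eVB parx) => // e'; have := congr1 size e'.
    by rewrite size_cat /=; clear; lia.
  have [G2 eG] : exists G2, G = rcons B p ++ G2.
    by apply: (@cylinder _ G U'); rewrite cat_rcons // ep -e.
  have lG2 : wlt G G2.
    by move: lB; rewrite {2}eG -cat_rcons wlt_cat parB.
  case: (maxG (rcons P0 p ++ rcons B p) G2) => [||eG2|].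
  + by rewrite ePG -catA -eG.
  + by rewrite par_cat parB addbF.
  + by move: lG2; rewrite eG2 wlt_irr.
  + by move/(wlt_asym lG2).
have oddR Q r' : V = Q ++ ~~ par Q :: r' -> V = rcons Q (~~ par Q) ++ r' /\ par (rcons Q (~~ par Q)).
  by rewrite cat_rcons par_rcons addbN addbb.
have lbP0 : tail_bound (par V) V P0.
  move=> A1 V1 r1 A10 e1 e1'; move: (e1') => /oddR [e2 odd2] ex.
  (* If [r1] exceeds [P0], then [G] starts with [P0 p] twice, and the odd prefix [(P0 p)^3] of [V]
     leaves a suffix above [G]. *)
  case: (wlt_total r1 P0) => [er|//|h]; last first.
    have r1V : wlt r1 V := suf_lt _ _ e2 odd2.
    have [Y1 er lY1] : exists2 Y1, r1 = P0 ++ p :: Y1 & wlt G Y1.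
      have [|Y1 er lY1] := between_o (A := G) h; first by rewrite -pp -eV0.
      by exists Y1 => //; rewrite pp.
    have [G2 eG] : exists G2, G = rcons P0 p ++ G2.
      case: (maxG _ _ e2 odd2) => [e|h1].
        by exists Y1; rewrite -e er cat_rcons.
      apply: (@cylinder _ Y1 G); rewrite -?ePG //.
      by rewrite cat_rcons -er.
    have G2V : wlt G2 V.
      by apply: (mV ((rcons P0 p) ++ (rcons P0 p))); [rewrite ePG -catA -eG|case: (P0)].
    have lGG2 : wlt G G2.
      by move: GV; rewrite {1}eG [in X in wlt _ X]ePG wlt_cat oddP.
    have [G3 eG2] : exists G3, G2 = rcons P0 p ++ G3.
      by apply: (@cylinder _ G2 G); rewrite -?eG -?ePG.
    have lGG3 : wlt G G3.
      by move: G2V; rewrite eG2 [in X in wlt _ X]ePG wlt_cat oddP.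
    case: (maxG (rcons P0 p ++ rcons P0 p ++ rcons P0 p) G3) => [||eG3|].
    - by rewrite ePG -!catA -eG2 -eG.
    - by rewrite !par_cat oddP.
    - by move: lGG3; rewrite eG3 wlt_irr.
    - by move/(wlt_asym lGG3).
  (* If [r1 = P0], then [V e] is a product of two commuting odd words, which [no_doubling]
     excludes. *)
  have eV1 : V1 = G.
    have sz : size V1 = size G.
      have := congr1 size eV0; rewrite {1}e1' er !size_cat /=; clear; lia.
    have := ePG; rewrite e1 => /eqP; rewrite eqseq_cat ?sz.
      by move=> /andP[_ /eqP].
    by have := congr1 size ePG; rewrite {1}e1 !size_cat sz => /addIn.
  subst V1; have eV2 : V = rcons G (par V) ++ P0 by rewrite ex -er.
  have oddG : par (rcons G (par V)) by rewrite ex.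
  have ep : p = par V.
    have := congr1 par eV2; rewrite {1}ePG !par_cat oddP oddG.
    move: oddP; rewrite par_rcons.
    by rewrite pV; case: (par P0); case: (p); case: (par G).
  have com : rcons P0 p ++ rcons G (par V) = rcons G (par V) ++ rcons P0 p.
    by rewrite -rcons_cat -ePG -rcons_cat -eV2 {1}ep.
  have eZ : V ++ par V :: Z = rcons P0 p ++ rcons G (par V) ++ Z.
    by rewrite -cat_rcons {1}ePG rcons_cat catA.
  have eZ' : V ++ par V :: Z = rcons G (par V) ++ rcons P0 p ++ Z.
    by rewrite eZ catA com catA.
  case: (no_doubling oddP oddG com (Z := Z)).
  - have := mZ _ _ eZ; rewrite eZ' wlt_cat oddG; apply.
    by case: (P0).
  - have := mZ _ _ eZ'; rewrite eZ wlt_cat oddP; apply.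
    by case: (G).
  - rewrite -eZ; exact: (shift_max_ext_suf mZ (A := [::])).
exists K; split.
- by rewrite /K {2}eV0 !size_cat /=; clear; lia.
- apply/belowP => Q B e; case: (cat_cons_split e) => [[G' [eG ->]]|[Q' [_ eP]]].
    apply: (junction (A := rcons P0 p ++ Q)) => //; first by rewrite ePG eG catA.
    by case: (P0).
  by move/belowP: bP0 => /(_ _ _ eP).
- move=> A1 V1 r1 _ _ /oddR [e2 odd2] _; apply: leK; exact: maxG e2 odd2.
move=> W; apply: wlt_trans (leK _ (maxG _ _ eVr pr)).
suff -> : ~~ par V = par r by apply: wlt_e.
by have := congr1 par eVr; rewrite par_cat pr => ->; rewrite negbK.
Qed.

(** * Flipping a letter *)

(** A start with [RR] is excluded by [no_doubling] for two copies of [R]. *)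
Lemma shift_max_head w : shift_max w ->
  w = [::] \/ exists2 w', w = true :: w' & head false w' = false.
Proof.
case: w => [|x w] mw; first by left.
right; have hx : x by have := mw (x :: w) [::]; rewrite cats0 wltE; apply.
case: x hx mw => // _ mw; exists w => //.
case: w mw => [|[] w] // mw.
have h1 : wlt (true :: w) w by have := mw [:: true] (true :: w); rewrite wltE; apply.
case: (@no_doubling [:: true] [:: true] w) => //=.
by apply: (mw [:: true; true]).
Qed.

Lemma below_nseq V k : shift_max V -> 1 < size V -> below V (nseq k true).
Proof.
move=> /shift_max_head [->//|[[|x V'] -> //= ->]] _.
by elim: k => [|[|[|k]] IH] //; rewrite /below -/(nseq _ _) /= in IH *; rewrite IH wltE.
Qed.

(** Passes from the tail [Z'], allowed behind [V o], to [Z] itself; only the conditions at borders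
    of [V] are at stake. *)
Lemma flip_maximal V Z Z' : shift_max (V ++ par V :: Z) ->
  shift_max (V ++ ~~ par V :: Z') ->
  size Z' = size Z -> ~ bigger V Z -> shift_max (V ++ ~~ par V :: Z) /\ head true Z.
Proof.
move=> mZ mZ' sZ' nb; have mV := shift_max_common mZ mZ'; split; last first.
  (* If [Z] began with [L], the word [RR...R] would be larger, and all its suffixes lie below
     [V]. *)
  case: Z mZ sZ' nb => [|[] X] // mZ sZ' []; apply: (below_bigger (Z1 := nseq (size X).+1 true)) => //.
  - apply: below_nseq => //.
    case: (V) mZ => [|v [|v' V0]] //= /shift_max_head [//|[w']] //.
    by move=> [-> <-].
  - by rewrite size_nseq.
case: (wlt_total Z' Z) => [<- //|lZ'|lZ].
(* [r o] is even, so by [even_down] a violation [Z < r o Z] would pass down to [Z' < Z]. *)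
- apply: shift_max_extI => // [A B e|A V' r A0 eV eV' ex].
    exact: wlt_trans (shift_max_ext_suf mZ e) (wlt_diff1 _ _ _).
  have h := shift_max_ext_lb mZ' A0 eV eV' ex.
  have pr : ~~ par V = par r.
    have := congr1 par eV'; rewrite par_cat /=.
    by case: (par V); case: (par V'); case: (par r).
  case: (wlt_total Z (rcons r (~~ par V) ++ Z)) => [e|h1|]; last by rewrite cat_rcons.
    by have := congr1 size e; rewrite size_cat size_rcons; clear; lia.
  have := even_down _ _ lZ' h1; rewrite par_rcons pr addbb cat_rcons -pr.
  by move=> h2; case: (wlt_asym h (h2 _ _)); case: (r).
- have [//|[bs eZ']] := bigger_or_star mZ mZ' sZ' lZ.
  apply: shift_max_extI => // [A B e|A V' r A0 eV eV' ex].
    exact: wlt_trans (shift_max_ext_suf mZ e) (wlt_diff1 _ _ _).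
  case: (wlt_total Z (r ++ ~~ par V :: Z)) => [e|h|//].
    by have := congr1 size e; rewrite size_cat /=; clear; lia.
  (* The violation puts [K] above [Z]; padded with as many [V e] as [bs] has letters, [K] gets the
     length of [Z] and contradicts [nb]. *)
  have [K [sK bK lbK lK]] := odd_suffix_word mV mZ A0 eV eV' (negb_inj ex).
  have lZK := wlt_trans h (lK Z).
  have [b1 _ l1] := pow_e_facts (size bs) mV (below_good (shift_max_e_below mZ)) bK lbK lZK.
  case: nb; apply: below_bigger b1 _ l1 => //.
  by rewrite -sZ' eZ' !size_sub size_nseq sK.
Qed.

(** * Star products *)

(** At the first difference [T'] between the word and a larger one, the induction excludes larger
    tails, so [flip_maximal] makes the flip after [T'] legal. The condition on [head true X] says
    that the flipped letter ends a cell. *)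
Lemma not_bigger V Z : shift_max (V ++ par V :: Z) ->
  (forall T X, V ++ par V :: Z = T ++ par T :: X -> size V < size T ->
     head true X -> ~ shift_max (T ++ ~~ par T :: X)) ->
  ~ bigger V Z.
Proof.
move=> mZ noflip.
suff gen T X : V ++ par V :: Z = T ++ par T :: X -> size V <= size T -> ~ bigger T X.
  exact: gen.
have [k] := ubnP (size X); elim: k T X => // k IH T X szX eT szT [X' [sX' lX mX']].
case: (prefix_or_diff X X') => [[Y e]|[Y e]|[G [x [X2 [X2' [e e']]]]]].
- move: sX' lX; rewrite e size_cat; case: Y {e} => [|y Y]; first by rewrite cats0 wlt_irr.
  by rewrite /=; clear; lia.
- move: sX' lX; rewrite e size_cat; case: Y {e} => [|y Y]; first by rewrite cats0 wlt_irr.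
  by rewrite /=; clear; lia.
have ex : x = par G by move: lX; rewrite e e' wlt_diff; case: (x); case: (par G).
pose T' := T ++ par T :: G.
have pT' : par T' = par G by rewrite par_cat /= addbA addbb.
have eT' : V ++ par V :: Z = T' ++ par T' :: X2 by rewrite eT pT' -catA /= -ex -e.
have mT' : shift_max (T' ++ ~~ par T' :: X2') by rewrite pT' -catA /= -ex -e'.
have sX2 : size X2' = size X2.
  by move: sX'; rewrite e e' !size_cat /=; clear; lia.
have szT' : size V < size T' by rewrite size_cat /=; clear -szT; lia.
have [] := flip_maximal (V := T') (Z := X2) _ mT' sX2.
- by rewrite -eT'.
- apply: IH eT' _; last exact: ltnW.
  by move: szX; rewrite e size_cat /=; clear; lia.
by move=> m2 h2; apply: (noflip _ _ eT').
Qed.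

(** Serves both claims: [B] is [Z] for the first, and the larger tail of the star product for the
    second. *)
Lemma star_between V Z B c : shift_max (V ++ par V :: Z) -> ~ bigger V Z ->
  shift_max c ->
  size c = size (V ++ par V :: Z) -> Z = B \/ wlt Z B ->
  wlt (V ++ par V :: Z) c -> wlt c (V ++ ~~ par V :: B) ->
  exists bs, c = sub V (true :: bs) V.
Proof.
move=> mZ nb mc sc leB l1 l2; case: (between l1 l2) => [e|[Y e lY]|[Y e lY]].
- by move: sc; rewrite e size_cat /=; clear; lia.
- case: nb; exists Y; split=> //; last by rewrite -e.
  by move: sc; rewrite e !size_cat /=; clear; lia.
have lZY : wlt Z Y by case: leB => [->|/wlt_trans]; [|apply].
have [||//|[bs eY]] := bigger_or_star mZ (Z' := Y) _ _ lZY.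
- by rewrite -e.
- by move: sc; rewrite e !size_cat /=; clear; lia.
by exists bs; rewrite e eY.
Qed.

Lemma lt_sub V Z bs : good V Z -> wlt Z (sub V bs V).
Proof.
move=> gZ; elim: bs => [|[] bs IH] /=; first exact: good_lt.
- exact: wlt_trans (good_lt gZ) (wlt_o _ _).
- by apply: wlt_trans gZ _; rewrite wlt_ee.
Qed.

Lemma sub_pref V bs : exists W, sub V bs V = V ++ W.
Proof. by case: bs => [|b bs] /=; [exists [::]; rewrite cats0|eexists]. Qed.

(** The block of a letter [b] has parity [b], so it reverses the order exactly when [b] does. *)
Lemma wlt_sub V u v : wlt (sub V u V) (sub V v V) = wlt u v.
Proof.
suff [] : wlt (sub V u V) (sub V v V) = wlt u v /\
          wlt (sub V v V) (sub V u V) = wlt v u by [].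
elim: u v => [|a u IH] [|b v] /=.
- by rewrite !wlt_irr.
- by rewrite wlt_ext ext_wlt; case: (par V); case: b.
- by rewrite wlt_ext ext_wlt; case: (par V); case: a.
have [h1 h2] := IH v; rewrite !wlt_cat.
by case: (par V); case: a; case: b; rewrite /= !wltE.
Qed.

Lemma sub_split V bs A B : sub V bs V = A ++ B ->
  [\/ exists b1 b2, [/\ bs = b1 ++ b2, A = sub V b1 [::] & B = sub V b2 V],
      exists A0 V' x b2,
        [/\ A0 <> [::], V = A0 ++ V' & B = V' ++ x :: sub V b2 V]
    | exists A0, A0 <> [::] /\ V = A0 ++ B].
Proof.
elim: bs A => [|b bs IH] [|a A] /=.
- by move=> <-; constructor 1; exists [::], [::].
- by move=> e; constructor 3; exists (a :: A).
- by move=> <-; constructor 1; exists [::], (b :: bs).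
move=> e; case: (cat_cons_split (A := a :: A) e) => [[V' [eV ->]]|[A' [-> /IH]]].
  by constructor 2; exists (a :: A), V', (b (+) par V), bs.
case=> [[b1 [b2 [-> -> ->]]]|[A0 [V' [x [b2 [n0 eV ->]]]]]|[A0 [n0 eV]]].
- by constructor 1; exists (b :: b1), b2.
- by constructor 2; exists A0, V', x, b2.
- by constructor 3; exists A0.
Qed.

Lemma shift_max_sub V bs : shift_max V -> shift_max (true :: bs) ->
  shift_max (sub V (true :: bs) V).
Proof.
move=> mV mb A B e A0.
case: (sub_split e) => [[b1 [b2 [eb eA ->]]]|[A1 [V' [x [b2 [n0 eV ->]]]]]|[A1 [n0 eV]]].
- by rewrite wlt_sub; apply: mb eb _ => b10; apply: A0; rewrite eA b10.
- have [W eW] := sub_pref V b2.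
  by apply: wlt_trans (wlt_o _ _); rewrite eW; apply: junction eV n0 (tail_bound_pref _ mV).
- exact: wlt_trans (mV _ _ eV n0) (wlt_o _ _).
Qed.

Lemma shift_max_of_sub V bs : shift_max (sub V bs V) -> shift_max bs.
Proof.
move=> ms A B eb A0; rewrite -(wlt_sub V); apply: (ms (sub V A [::])).
  by rewrite eb -sub_nil_cat; elim: (A) => //= b l ->.
by case: (A) A0 => // b l _; case: (V).
Qed.

(** * Words of alpha-sequences *)

(* A cell of value [x] becomes the block [R L^(x-1)], with [R = true] and [L = false]. *)
Definition enc (a : seq nat) : word :=
  flatten [seq true :: nseq x.-1 false | x <- a].

Definition pos (a : seq nat) : bool := all (fun x => 0 < x) a.

Lemma enc_cons x a : enc (x :: a) = true :: nseq x.-1 false ++ enc a.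
Proof. by []. Qed.

Arguments enc : simpl never.

Lemma enc_cat a b : enc (a ++ b) = enc a ++ enc b.
Proof. by rewrite /enc map_cat flatten_cat. Qed.

Lemma size_enc a : pos a -> size (enc a) = degree a.
Proof.
elim: a => // x a IH; rewrite enc_cons => /andP[x0 /IH e].
rewrite /= size_cat size_nseq e /degree /=; clear -x0; lia.
Qed.

Lemma par_enc a : par (enc a) = odd (size a).
Proof.
elim: a => // x a IH; rewrite enc_cons /= par_cat -IH.
by have -> : par (nseq x.-1 false) = false by elim: x.-1.
Qed.

Lemma enc_eq0 a : (enc a == [::]) = (a == [::]).
Proof. by case: a. Qed.

Lemma head_enc a : head true (enc a).
Proof. by case: a. Qed.

Lemma alt_lt_cons x y a b :
  alt_lt (x :: a) (y :: b) <-> x < y \/ (x = y /\ alt_lt b a).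
Proof.
have AlS z c j : Al (z :: c) j.+1 = (- Al c j)%R.
  by rewrite /Al /= GRing.exprS !GRing.mulNr GRing.mul1r.
split=> [[[|j] [h1 h2]]|[h|[-> [j [h1 h2]]]]].
- by left; move: h2; rewrite /Al /= !GRing.expr0; clear; lia.
- have h0 := h1 0 isT; move: h0; rewrite /Al /= !GRing.expr0 => h0.
  right; split; first by clear -h0; lia.
  exists j; split=> [k kj|]; last by move: h2; rewrite !AlS; clear; lia.
  by have := h1 k.+1 kj; rewrite !AlS; clear; lia.
- by exists 0; split=> //; rewrite /Al /= !GRing.expr0; clear -h; lia.
- exists j.+1; split=> [[|k] kj|]; first by rewrite /Al /= !GRing.expr0; clear; lia.
    by have := h1 k kj; rewrite !AlS; clear; lia.
  by move: h2; rewrite !AlS; clear; lia.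
Qed.

Lemma alt_lt_nil : ~ alt_lt [::] [::].
Proof. by case=> j [_]; rewrite GRing.subrr Order.POrderTheory.ltxx. Qed.

Lemma alt_lt_nil_cons y b : 0 < y -> alt_lt [::] (y :: b).
Proof.
by move=> h; exists 0; split=> //; rewrite /Al /= !GRing.expr0; clear -h; lia.
Qed.

Lemma alt_lt_cons_nil x a : 0 < x -> ~ alt_lt (x :: a) [::].
Proof.
move=> x0 [[|j] [h1 h2]].
  by move: h2; rewrite /Al /= !GRing.expr0; clear -x0; lia.
have h0 := h1 0 isT; move: h0; rewrite /Al /= !GRing.expr0; clear -x0; lia.
Qed.

Lemma wlt_nseq x y A B : head true A -> head true B ->
  wlt (nseq y false ++ B) (nseq x false ++ A) = (x < y) || ((x == y) && wlt B A).
Proof.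
elim: y x => [|y IH] [|x] hA hB //=.
- by case: B hB => [|[] B].
- by case: A hA IH => [|[] A].
- by rewrite wltE IH.
Qed.

(** The [R] opening a block reverses the order, so more letters [L] give a larger word, and equal
    first cells swap the tails, as in [alt_lt_cons]. *)
Lemma alt_ltE a b : pos a -> pos b -> alt_lt a b <-> wlt (enc a) (enc b).
Proof.
have [k] := ubnP (size a + size b); elim: k a b => // k IH [|x a] [|y b] //=.
- by move=> _ _ _; split=> // /alt_lt_nil.
- by move=> _ _ /andP[y0 _]; split=> // _; apply: alt_lt_nil_cons.
- by move=> _ /andP[x0 _] _; split=> // /(alt_lt_cons_nil x0).
move=> sz /andP[x0 pa] /andP[y0 pb].
have {}IH : alt_lt b a <-> wlt (enc b) (enc a) by apply: IH => //; clear -sz; lia.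
rewrite !enc_cons wltE wlt_nseq ?head_enc //.
have -> : (x.-1 < y.-1) = (x < y) by clear -x0 y0; lia.
have -> : (x.-1 == y.-1) = (x == y) by clear -x0 y0; lia.
rewrite alt_lt_cons IH; split=> [[->//|[-> ->]]|].
  by rewrite eqxx orbT.
by case/orP=> [->|/andP[/eqP -> ->]]; [left|right].
Qed.

Lemma nseq_cat_split k E A B : nseq k false ++ E = A ++ B -> head true B ->
  exists2 A', A = nseq k false ++ A' & E = A' ++ B.
Proof.
elim: k A => [|k IH] [|x A] /=.
- by move=> -> _; exists [::].
- by move=> -> _; exists (x :: A).
- by move=> <-.
- by move=> [<- /IH h /h [A' -> ->]]; exists A'.
Qed.

Lemma enc_split a A B : enc a = A ++ B -> head true B ->
  exists a1 a2, [/\ a = a1 ++ a2, enc a1 = A & enc a2 = B].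
Proof.
elim: a A => [|x a IH] [|t A] //=.
- by move=> <- _; exists [::], [::].
- by move=> <- _; exists [::], (x :: a).
rewrite enc_cons => -[<- h] hB.
have [A' -> /IH [//|a1 [a2 [-> <- <-]]]] := nseq_cat_split h hB.
by exists (x :: a1), a2.
Qed.

Lemma decode w : exists k a, pos a /\ w = nseq k false ++ enc a.
Proof.
elim: w => [|[] w [k [a [pa ->]]]]; first by exists 0, [::].
- by exists 0, (k.+1 :: a); rewrite /= pa.
- by exists k.+1, a.
Qed.

Lemma decode_true w : exists2 a, pos a & true :: w = enc a.
Proof.
have [[|k] [a [pa e]]] := decode (true :: w) => //.
by exists a.
Qed.

Lemma lexical_mx a : pos a -> lexical a <-> shift_max (enc a).
Proof.
move=> pa.
have sub_pos a1 a2 : a = a1 ++ a2 -> pos a2.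
  by move=> e; move: pa; rewrite e /pos all_cat => /andP[].
split=> [la A B e A0|ma i ia].
  have [w ew] : exists w, enc a = true :: w.
    by case: (a) e => [|x l] /=; [case: A A0|rewrite enc_cons; eexists].
  (* Only suffixes starting with [R] are cuts between cells; the others lie below any word starting
     with [R]. *)
  case: B e => [|[] B] e; try by rewrite ew.
  have [a1 [a2 [ea e1 e2]]] := enc_split e isT.
  have -> : true :: B = enc a2 by [].
  apply/alt_ltE => //; first exact: sub_pos ea.
  have := la (size a1).+1; rewrite ea /= drop_size_cat //; apply.
  rewrite size_cat; case: a1 e1 {ea} => [|x a1] e1; first by case: A0.
  by case: a2 e2 => [//|y a2] _ /=; clear; lia.
have e : a = take i.-1 a ++ drop i.-1 a by rewrite cat_take_drop.
apply/alt_ltE => //; first exact: sub_pos e.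
apply: (ma (enc (take i.-1 a))); first by rewrite -enc_cat -e.
have /andP[i2 /(leq_trans (leq_pred i)) isz] := ia.
move=> /eqP; rewrite enc_eq0 -size_eq0 size_takel //.
by clear -i2; lia.
Qed.

(** [1 < n] excludes the sequence [(0)], whose encoding has one letter although its degree is 0. *)
Lemma L_enc n a : 1 < n ->
  L n a <-> [/\ pos a, a <> [::], shift_max (enc a) & n = (size (enc a)).+1].
Proof.
move=> n1; split=> [[al la en]|[pa a0 ma ->]].
  have [pa a0] : pos a /\ a <> [::].
    case/orP: al => [/eqP e|/andP[/eqP a0 pa]] //.
    by move: n1; rewrite -en e.
  split=> //; first exact/lexical_mx.
  by rewrite size_enc.
split; last by rewrite size_enc.
- by rewrite /alpha_seq; apply/orP; right; apply/andP; split=> //; apply/eqP.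
- exact/lexical_mx.
Qed.

(** * Elementary operations and star products on words *)

Lemma wedge_cat a0 a b : wedge (a0 ++ a) (a0 ++ b) = a0 ++ wedge a b.
Proof. by elim: a0 => //= x a0 ->; rewrite eqxx. Qed.

Lemma nseqS_cat k (x : bool) W : nseq k.+1 x ++ W = nseq k x ++ x :: W.
Proof. by elim: k => //= k ->. Qed.

(** On the last letter of the block of an even cell, splitting turns [L] into [R] and conjugation
    turns [R] into [L]; the word before that letter encodes the wedge. *)
Lemma elem_op_enc a0 x a2 : pos (a0 ++ x :: a2) -> odd (size a0) ->
  exists b T, [/\ elem_op (size a0).+1 (a0 ++ x :: a2) = Some b, pos b,
    enc (a0 ++ x :: a2) = T ++ par T :: enc a2,
    enc b = T ++ ~~ par T :: enc a2 &
    [/\ pos (wedge (a0 ++ x :: a2) b), wedge (a0 ++ x :: a2) b <> [::]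
      & enc (wedge (a0 ++ x :: a2) b) = T]].
Proof.
rewrite /pos all_cat /= => /and3P[p0 x0 p2] o0.
have ecell : cell (a0 ++ x :: a2) (size a0).+1 = x.
  by rewrite /cell nth_cat ltnn subnn.
have edrop : drop (size a0).+1 (a0 ++ x :: a2) = a2.
  by rewrite -cat_rcons drop_size_cat // size_rcons.
have esz : (0 < (size a0).+1 <= size (a0 ++ x :: a2)).
  by rewrite size_cat /=; clear; lia.
rewrite /elem_op esz /= ecell.
case: x x0 ecell edrop esz => [|[|x]] // _ ecell edrop esz; last first.
  have pT : par (enc (a0 ++ [:: x.+1])) = false.
    by rewrite par_enc size_cat addn1 /= o0.
  have eb : splitting (size a0).+1 (a0 ++ x.+2 :: a2) = a0 ++ [:: x.+1, 1 & a2].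
    by rewrite /splitting ecell edrop take_size_cat.
  exists (a0 ++ [:: x.+1, 1 & a2]), (enc (a0 ++ [:: x.+1])).
  rewrite pT eb wedge_cat !enc_cat /=.
  have -> : minn x.+2 x.+1 = x.+1 by clear; lia.
  have -> : (x.+2 == x.+1) = false by clear; lia.
  split=> //.
  - by rewrite all_cat /= p0.
  - rewrite -catA !enc_cons /= cats0; congr (_ ++ _ :: _).
    exact: nseqS_cat.
  - by rewrite -catA !enc_cons /= cats0.
  - split; rewrite ?all_cat ?p0 // ?enc_cat //.
    by case: (a0).
case/lastP: a0 p0 o0 ecell edrop esz => // a0 y p0 o0 ecell edrop esz.
move: p0; rewrite all_rcons => /andP[y0 p0].
have pT : par (enc (rcons a0 y)) = true by rewrite par_enc.
have eb : conjugation (size (rcons a0 y)).+1 (rcons a0 y ++ 1 :: a2) = a0 ++ y.+1 :: a2.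
  rewrite /conjugation edrop size_rcons /= /cell /= cat_rcons take_size_cat //.
  by rewrite nth_cat ltnn subnn.
exists (a0 ++ y.+1 :: a2), (enc (rcons a0 y)).
rewrite pT eb cat_rcons wedge_cat /=.
have -> : minn y y.+1 = y by clear; lia.
have -> : (y == y.+1) = false by clear; lia.
rewrite size_rcons /= -cats1 !enc_cat /=; split=> //.
- by rewrite all_cat /= p0.
- by rewrite -catA !enc_cons /= cats0.
- rewrite -catA !enc_cons /= cats0; congr (_ ++ _ :: _).
  by case: y y0 {pT eb o0 ecell edrop esz} => // y _; exact: nseqS_cat.
- split; rewrite ?all_cat ?p0 /= ?y0 // ?enc_cat //.
  by case: (a0).
Qed.

Lemma sub_cat V b1 b2 W : sub V (b1 ++ b2) W = sub V b1 (sub V b2 W).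
Proof. by elim: b1 => //= b b1 ->. Qed.

Lemma incr_nth_rcons a x : incr_nth (rcons a x) (size a) = rcons a x.+1.
Proof. by elim: a => //= y a ->. Qed.

(** Increasing the tail appends [L], a new cell 1 appends [R]. *)
Lemma enc_seq_oe f : pos f -> f <> [::] ->
  [/\ pos (seq_o f), pos (seq_e f), enc (seq_o f) = rcons (enc f) (~~ par (enc f))
    & enc (seq_e f) = rcons (enc f) (par (enc f))].
Proof.
case/lastP: f => // f x; rewrite /pos all_rcons => /andP[x0 pf] _.
have eS : enc (rcons f x.+1) = rcons (enc (rcons f x)) false.
  rewrite -!cats1 !enc_cat -catA; congr (_ ++ _); rewrite !enc_cons /= !cats0.
  by case: x x0 => // x _ /=; rewrite -(nseqD x 1 false) addn1.
have e1 : enc (rcons (rcons f x) 1) = rcons (enc (rcons f x)) true.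
  by rewrite -!cats1 !enc_cat.
rewrite /seq_o /seq_e par_enc size_rcons /= incr_nth_rcons.
by case: (odd _); split; rewrite ?all_rcons ?pf ?x0.
Qed.

(** The factor for a cell [x] is the substitution of [V] into [R L^(x-1)]. *)
Lemma star_enc f l : pos f -> f <> [::] -> pos l ->
  pos (star f l) /\ enc (star f l) = sub (enc f) (enc l) (enc f).
Proof.
move=> pf f0; have [po pe eo ee] := enc_seq_oe pf f0.
rewrite /star; elim: l => [|x l IH] //= /andP[x0 /IH [p1 e1]].
have [p2 e2] : pos (seq_pow (seq_e f) x.-1) /\
    forall W, enc (seq_pow (seq_e f) x.-1) ++ W = sub (enc f) (nseq x.-1 false) W.
  rewrite /seq_pow; elim: x.-1 => [|k [q1 q2]] //=; split.
    by rewrite /pos all_cat; apply/andP.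
  by move=> W; rewrite enc_cat ee cat_rcons -q2 -catA.
split.
  by rewrite -!catA /pos all_cat all_cat; apply/and3P.
by rewrite -!catA enc_cat enc_cat e1 e2 eo cat_rcons sub_cat.
Qed.

Lemma size_enc_prefix a1 a2 b1 b2 : a1 ++ a2 = b1 ++ b2 ->
  size a1 <= size b1 -> size (enc a1) <= size (enc b1).
Proof.
move=> e sz; have -> : a1 = take (size a1) b1.
  by rewrite -(takel_cat b2 sz) -e take_size_cat.
by rewrite -[X in _ <= size (enc X)](cat_take_drop (size a1)) enc_cat size_cat leq_addr.
Qed.

(** * Adjacency in [L n] from the results on words *)

Theorem theorem3p1 (n m d r i : nat) (a a' : seq nat)
  (a_in : L n a)
  (a_not_max : ~ is_maximal (L n) a)
  (a'_in : L n a')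
  (i_even : ~~ odd i)
  (op_i : elem_op i a = Some a')
  (i_largest : forall (j : nat) (b : seq nat),
     ~~ odd j -> i < j -> elem_op j a = Some b -> ~ L n b)
  (f_in : L m (wedge a a'))
  (n_eq : n = m * d + r)
  (r_lt : r < m) :
  (0 < r -> adjacent (L n) a a') /\
  (r = 0 -> forall lambda : seq nat, is_least (L d) lambda ->
     adjacent (L n) a (star (wedge a a') lambda)).
Proof.
have isz : 0 < i <= size a by move: op_i; rewrite /elem_op; case: ifP => // /negbFE.
have i0 : 0 < i by case/andP: isz.
have n1 : 1 < n.
  case: a_in => /orP[/eqP ea|/andP[a0 pa]] _ <-.
    by move: isz i_even; rewrite ea; case: (i) => [|[|j]].
  by case: (a) a0 pa => // -[|y] l.
have /(L_enc _ n1) [pa a0 ma en] := a_in.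
pose a0' := take i.-1 a; pose a2 := drop i a.
have [x ea] : exists x, a = a0' ++ x :: a2.
  exists (nth 0 a i.-1); rewrite -{1}[a](cat_take_drop i.-1); congr (_ ++ _).
  have lt : i.-1 < size a by rewrite prednK //; case/andP: isz.
  by rewrite (drop_nth 0 lt) prednK.
have sz0 : size a0' = i.-1.
  by rewrite size_takel //; case/andP: isz => _; apply: leq_trans (leq_pred i).
have o0 : odd (size a0') by rewrite sz0; case: (i) i0 i_even => //= j _ /negbNE.
have ei : (size a0').+1 = i by rewrite sz0 prednK.
have pa' : pos (a0' ++ x :: a2) by rewrite -ea.
have [b [V [op_b pb ewa eb [pf f0 ef]]]] := elem_op_enc pa' o0.
move: op_b pf f0 ef ewa; rewrite -ea ei op_i => -[eab].
rewrite -{}eab in eb pb * => {b} pf f0 ef ewa.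
set f := wedge a a' in f_in pf f0 ef *; set Z := enc a2 in eb ewa.
have em : m = (size V).+1 by case: f_in => _ _ <-; rewrite -ef size_enc.
have mZ : shift_max (V ++ par V :: Z) by rewrite -ewa.
have mZ' : shift_max (V ++ ~~ par V :: Z) by case/(L_enc _ n1): a'_in => _ _; rewrite eb.
have mV := shift_max_common mZ mZ'.
(* A legal flip further right would be an elementary operation on an even cell beyond [i], against
   [i_largest]. *)
have nb : ~ bigger V Z.
  apply: not_bigger => // T X; rewrite -ewa -cat_rcons => eT szT hX mT.
  have [a1 [a3 [e13 e1 e3]]] := enc_split eT hX.
  case/lastP: a1 e13 e1 => [_|a1 y e13 e1]; first by case: (T).
  have o1 : odd (size a1).
    have := par_enc (rcons a1 y); rewrite e1 par_rcons addbb size_rcons /=.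
    by move/esym/negbFE.
  have e13' : a = a1 ++ y :: a3 by rewrite e13 cat_rcons.
  have p13 : pos (a1 ++ y :: a3) by rewrite -e13'.
  have [b [T' [op_b pb' ewa' eb' _]]] := elem_op_enc p13 o1.
  have eTT : T' = T.
    move: ewa'; rewrite -e13' eT e3 cat_rcons => e.
    have sTT : size T = size T'.
      by have := congr1 size e; rewrite !size_cat /= => /addIn.
    by move/eqP: e; rewrite eqseq_cat // => /andP[/eqP ->].
  apply: (i_largest (size a1).+1 b); first by rewrite /= o1.
  - rewrite ltnNge; apply/negP => le1.
    have := @size_enc_prefix (rcons a1 y) a3 (rcons a0' x) a2.
    rewrite -e13 cat_rcons -ea !size_rcons ei => /(_ erefl le1).
    have -> : size (enc (rcons a0' x)) = (size V).+1.
      have := congr1 size ewa; rewrite {1}ea -cat_rcons enc_cat !size_cat /=.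
      by rewrite -/Z addnS -addSn => /addIn.
    by rewrite e1 size_rcons ltnS leqNgt szT.
  - by rewrite e13'.
  apply/L_enc => //; split=> //.
  - by move=> e; move: eb'; rewrite e; case: (T').
  - by rewrite eb' e3 eTT.
  - by rewrite en e13' ewa' eb' !size_cat.
have szZ c : L n c -> size (enc c) = size (V ++ par V :: Z).
  by case/(L_enc _ n1) => _ _ _; rewrite en ewa => -[].
have between_star s B c : pos s -> enc s = V ++ ~~ par V :: B -> Z = B \/ wlt Z B ->
    L n c -> alt_lt a c -> alt_lt c s -> exists bs, enc c = sub V (true :: bs) V.
  move=> ps es leB Lc; have /(L_enc _ n1) [pc _ mc _] := Lc.
  move=> /(alt_ltE pa pc); rewrite ewa => l1 /(alt_ltE pc ps); rewrite es => l2.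
  exact: star_between mZ nb mc (szZ c Lc) leB l1 l2.
split=> [r0|r0 l [Ll least_l]].
  split=> //; first by apply/alt_ltE; rewrite // ewa eb wlt_diff1.
  case=> c [Lc l1 l2].
  have [bs ec] := between_star _ _ _ pb eb (or_introl erefl) Lc l1 l2.
  have /(L_enc _ n1) [_ _ _ enc_n] := Lc.
  (* Each block has [m] letters and the final [V] has [m - 1], so [m] divides [n], against
     [0 < r < m]. *)
  have en' : n = (size bs).+2 * m.
    by rewrite enc_n ec size_sub em /= !mulSn; clear; lia.
  have := congr1 (modn^~ m) n_eq; rewrite {1}en' /= modnMl mulnC modnMDl modn_small //.
  by move=> e; move: r0; rewrite -e.
(* [V e Z] is longer than [V], so [n > m]. *)
have d1 : 1 < d.
  rewrite ltnNge; apply/negP => d1; move: en; rewrite n_eq r0 ewa size_cat /= em.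
  by case: d d1 {n_eq least_l Ll} => [|[|d]] // _; clear; lia.
have /(L_enc _ d1) [pl l0 ml ed] := Ll.
have [ps es] := star_enc pf f0 pl.
have [w ew] : exists w, enc l = true :: w by case: (l) l0 => [|y l'] // _; eexists.
have es' : enc (star f l) = V ++ ~~ par V :: sub V w V by rewrite es ef ew.
have lZ : wlt Z (sub V w V) by apply: lt_sub; apply: below_good; apply: shift_max_e_below mZ.
have size_star bs : (size (sub V bs V)).+1 = m * (size bs).+1.
  by rewrite size_sub em mulnS mulnC; clear; lia.
split=> //.
- apply/L_enc => //; split=> //.
  + by move=> e; move: es'; rewrite e; case: (V).
  + by rewrite es ef ew; apply: shift_max_sub => //; rewrite -ew.
  + by rewrite n_eq r0 addn0 es ef size_star -ed.
- by apply/alt_ltE; rewrite // ewa es' wlt_diff1.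
case=> c [Lc l1 l2].
have [bs ec] := between_star _ _ _ ps es' (or_intror lZ) Lc l1 l2.
have /(L_enc _ n1) [pc _ mc enc_n] := Lc.
(* [c] is the star product of [f] with a lexical [c'], which would lie in [L d] below its least
   element. *)
have mbs : shift_max (true :: bs) by apply: (@shift_max_of_sub V); rewrite -ec.
have [c' pc' ec'] := decode_true bs.
have Lc' : L d c'.
  apply/L_enc => //; rewrite -ec'; split=> //; first by move=> e; rewrite e in ec'.
  apply/eqP; rewrite -(eqn_pmul2l (_ : 0 < m)); last by rewrite em.
  by rewrite -[m * d]addn0 -[X in _ + X]r0 -n_eq enc_n ec -size_star.
have /(alt_ltE pc ps) := l2; rewrite es ef ec ec' wlt_sub => lt_c.
have [e|/eqP/(least_l _ Lc')] := eqVneq c' l; first by rewrite e wlt_irr in lt_c.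
by move=> /(alt_ltE pl pc') /(wlt_asym lt_c).
Qed.
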